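(* If $\Gamma$ and $\Sigma$ are triangle groups for which $\mathcal{C}(\Gamma)=\mathcal{C}(\Sigma)$, then $\Gamma\cong\Sigma$.
   Context: For a group $\Gamma$, $\mathcal{C}(\Gamma)$ denotes the set of isomorphism classes of the finite groups that are quotients (homomorphic images) of $\Gamma$. A triangle group is a group of the form $\Delta(r,s,t)=\langle x,y,z\mid xyz=x^r=y^s=z^t=1\rangle$ with $r,s,t$ positive integers (spherical, Euclidean and hyperbolic triangle groups, i.e. $1/r+1/s+1/t$ greater than, equal to or less than $1$, are all allowed). *)

(* Defs.v *)
From HB Require Import structures.
From mathcomp Require Import all_boot fingroup.
From mathcomp Require Import boolp.

Set Implicit Arguments.
Unset Strict Implicit.
Unset Printing Implicit Defensive.

Local Notation repr := generic_quotient.repr.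

Local Open Scope quotient_scope.
Local Open Scope group_scope.

(* The letter (x, false) of a word stands for the generator x, and (x, true)
   for its inverse.  *)
Definition word (X : choiceType) : Type := seq (X * bool).

Definition word_inv (X : choiceType) (w : word X) : word X :=
  rev [seq (a.1, ~~ a.2) | a <- w].

(* The congruence on words whose quotient is the group <X | R>.  *)
Inductive pres_eq (X : choiceType) (R : seq (word X)) :
    word X -> word X -> Prop :=
| pres_refl u : pres_eq R u u
| pres_sym u v : pres_eq R u v -> pres_eq R v u
| pres_trans v u w : pres_eq R u v -> pres_eq R v w -> pres_eq R u w
| pres_cancel u v x b : pres_eq R (u ++ [:: (x, b); (x, ~~ b)] ++ v) (u ++ v)
| pres_relator u v r : r \in R -> pres_eq R (u ++ r ++ v) (u ++ v).

Section PresentedGroup.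
Variables (X : choiceType) (R : seq (word X)).
Implicit Types u v w : word X.

Lemma pres_eq_catl w u v : pres_eq R u v -> pres_eq R (w ++ u) (w ++ v).
Proof.
elim=> {u v}.
- by move=> u; apply: pres_refl.
- by move=> u v _; apply: pres_sym.
- by move=> v u x _ + _; apply: pres_trans.
- by move=> u v x b; rewrite !(catA w); apply: pres_cancel.
- by move=> u v r Rr; rewrite !(catA w); apply: pres_relator.
Qed.

Lemma pres_eq_catr w u v : pres_eq R u v -> pres_eq R (u ++ w) (v ++ w).
Proof.
elim=> {u v}.
- by move=> u; apply: pres_refl.
- by move=> u v _; apply: pres_sym.
- by move=> v u x _ + _; apply: pres_trans.
- by move=> u v x b; rewrite -!catA; apply: pres_cancel.
- by move=> u v r Rr; rewrite -!catA; apply: pres_relator.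
Qed.

Lemma pres_eq_cat u u' v v' :
  pres_eq R u u' -> pres_eq R v v' -> pres_eq R (u ++ v) (u' ++ v').
Proof.
by move=> uu' vv'; apply: (pres_trans (pres_eq_catr v uu')); apply: pres_eq_catl.
Qed.

Lemma word_invK : involutive (@word_inv X).
Proof.
move=> w; rewrite /word_inv map_rev revK -map_comp -[RHS]map_id.
by apply: eq_map => -[x b] /=; rewrite negbK.
Qed.

Lemma pres_eq_invr w : pres_eq R (w ++ word_inv w) [::].
Proof.
elim: w => [|[x b] w IHw]; first exact: pres_refl.
rewrite /word_inv /= rev_cons -cats1 -/(word_inv w).
have -> : (x, b) :: w ++ word_inv w ++ [:: (x, ~~ b)] =
    [:: (x, b)] ++ (w ++ word_inv w) ++ [:: (x, ~~ b)] by rewrite -!catA.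
apply: (pres_trans (v := [:: (x, b)] ++ [::] ++ [:: (x, ~~ b)])).
  exact/pres_eq_catl/pres_eq_catr.
exact: (pres_cancel R [::] [::] x b).
Qed.

Lemma pres_eq_invl w : pres_eq R (word_inv w ++ w) [::].
Proof. by rewrite -{2}(word_invK w); apply: pres_eq_invr. Qed.

Lemma pres_eq_inv u v : pres_eq R u v -> pres_eq R (word_inv u) (word_inv v).
Proof.
move=> uv; apply: (pres_trans (v := word_inv u ++ (v ++ word_inv v))).
  by rewrite -{1}(cats0 (word_inv u)); apply/pres_eq_catl/pres_sym/pres_eq_invr.
rewrite catA -{2}(cat0s (word_inv v)); apply: pres_eq_catr.
apply: (pres_trans (v := word_inv u ++ u)); last exact: pres_eq_invl.
exact/pres_eq_catl/pres_sym.
Qed.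

Definition pres_rel : rel (word X) := fun u v => `[< pres_eq R u v >].

Lemma pres_rel_refl : reflexive pres_rel.
Proof. by move=> u; apply/asboolP/pres_refl. Qed.

Lemma pres_rel_sym : symmetric pres_rel.
Proof. by move=> u v; apply/asboolP/asboolP; apply: pres_sym. Qed.

Lemma pres_rel_trans : transitive pres_rel.
Proof.
by move=> v u w /asboolP uv /asboolP vw; apply/asboolP/(pres_trans uv vw).
Qed.

Canonical pres_equiv := EquivRel pres_rel pres_rel_refl pres_rel_sym pres_rel_trans.

Definition pres_group : Type := {eq_quot pres_equiv}.
HB.instance Definition _ := Choice.on pres_group.
HB.instance Definition _ := Quotient.on pres_group.

Lemma pres_eqP u v : \pi_pres_group u = \pi_pres_group v <-> pres_eq R u v.
Proof.
split=> [/eqmodP/asboolP // | uv]; first by apply/eqmodP/asboolP.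
Qed.

Definition pres_one : pres_group := \pi_pres_group [::].
Definition pres_mul (a b : pres_group) : pres_group :=
  \pi_pres_group (repr a ++ repr b).
Definition pres_inv (a : pres_group) : pres_group :=
  \pi_pres_group (word_inv (repr a)).

Lemma pres_eq_repr u : pres_eq R (repr (\pi_pres_group u)) u.
Proof. by apply/pres_eqP; rewrite reprK. Qed.

Lemma pres_mul_pi u v :
  pres_mul (\pi_pres_group u) (\pi_pres_group v) = \pi_pres_group (u ++ v).
Proof. by apply/pres_eqP/pres_eq_cat; apply: pres_eq_repr. Qed.

Lemma pres_inv_pi u :
  pres_inv (\pi_pres_group u) = \pi_pres_group (word_inv u).
Proof. exact/pres_eqP/pres_eq_inv/pres_eq_repr. Qed.

Lemma pres_mulA : associative pres_mul.
Proof.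
elim/quotW=> u; elim/quotW=> v; elim/quotW=> w.
by rewrite (pres_mul_pi v w) (pres_mul_pi u v) !pres_mul_pi catA.
Qed.

Lemma pres_mul1 : left_id pres_one pres_mul.
Proof. by elim/quotW=> u; rewrite pres_mul_pi. Qed.

Lemma pres_mulr1 : right_id pres_one pres_mul.
Proof. by elim/quotW=> u; rewrite pres_mul_pi cats0. Qed.

Lemma pres_mulV : left_inverse pres_one pres_inv pres_mul.
Proof.
elim/quotW=> u; rewrite pres_inv_pi pres_mul_pi.
exact/pres_eqP/pres_eq_invl.
Qed.

Lemma pres_mulrV : right_inverse pres_one pres_inv pres_mul.
Proof.
elim/quotW=> u; rewrite pres_inv_pi pres_mul_pi.
exact/pres_eqP/pres_eq_invr.
Qed.

HB.instance Definition _ := isGroup.Build pres_group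
  pres_mulA pres_mul1 pres_mulr1 pres_mulV pres_mulrV.

Definition pres_gen (x : X) : pres_group := \pi_pres_group [:: (x, false)].

Definition word_eval (G : groupType) (g : X -> G) (w : word X) : G :=
  \prod_(a <- w) (if a.2 then (g a.1)^-1 else g a.1).

Lemma pres_relator_eq1 w : w \in R -> word_eval pres_gen w = 1.
Proof.
move=> Rw; suff -> : word_eval pres_gen w = \pi_pres_group w.
  by apply/pres_eqP; rewrite -[w]cats0; apply: (pres_relator [::] [::] Rw).
elim: w {Rw} => [|[x b] w IHw]; first by rewrite /word_eval big_nil.
rewrite /word_eval big_cons -/(word_eval pres_gen w) IHw.
by case: b; rewrite /= ?[(pres_gen x)^-1]pres_inv_pi [LHS]pres_mul_pi.
Qed.

Lemma pres_eq_eval (G : groupType) (g : X -> G) u v :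
    (forall r, r \in R -> word_eval g r = 1) ->
  pres_eq R u v -> word_eval g u = word_eval g v.
Proof.
move=> Rg; elim=> {u v} //.
- by move=> v u w _ -> _.
- move=> u v x b; rewrite /word_eval !big_cat !big_cons big_nil /=.
  by case: b; rewrite /= mulg1 ?mulVg ?mulgV mul1g.
- by move=> u v r /Rg; rewrite /word_eval !big_cat /= => ->; rewrite mul1g.
Qed.

(* The universal property of <X | R>.  *)
Lemma pres_lift (G : groupType) (g : X -> G) :
    (forall r, r \in R -> word_eval g r = 1) ->
  exists! f : pres_group -> G,
    {morph f : a b / a * b} /\ (forall x, f (pres_gen x) = g x).
Proof.
move=> Rg; pose f (a : pres_group) := word_eval g (repr a).
have fE u : f (\pi_pres_group u) = word_eval g u.
  exact: pres_eq_eval Rg (pres_eq_repr u).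
exists f; split.
  split=> [|x]; last by rewrite fE /word_eval big_seq1.
  elim/quotW=> u; elim/quotW=> v.
  by rewrite [X in f X]pres_mul_pi !fE /word_eval big_cat.
move=> h [hM hg]; apply/funext; elim/quotW=> u; rewrite fE.
have h1 : h 1 = 1 by apply: (mulgI (h 1)); rewrite -hM !mulg1.
have hV b : h b^-1 = (h b)^-1.
  by apply: (mulgI (h b)); rewrite -hM !mulgV.
elim: u => [|[x b] w IHw]; first by rewrite /word_eval big_nil -h1.
rewrite /word_eval big_cons -/(word_eval g w) IHw -[_ :: w]cat1s.
rewrite -pres_mul_pi [in RHS]hM; congr (_ * _).
case: b => /=; last by rewrite -hg.
by rewrite -hg -hV; congr h; rewrite [LHS]pres_inv_pi.
Qed.

End PresentedGroup.

(* x, y and z are the generators numbered 0, 1 and 2.  *)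
Definition triangle_relators (r s t : nat) : seq (word 'I_3) :=
  let x := (inord 0 : 'I_3, false) in
  let y := (inord 1 : 'I_3, false) in
  let z := (inord 2 : 'I_3, false) in
  [:: [:: x; y; z]; nseq r x; nseq s y; nseq t z].

Definition triangle_group (r s t : nat) : groupType :=
  pres_group (triangle_relators r s t).

Definition isomorphic (G H : groupType) : Prop :=
  exists f : {multiplicative G -> H}, bijective f.

Definition is_triangle_group (G : groupType) : Prop :=
  exists r s t : nat,
    [/\ (0 < r)%N, (0 < s)%N, (0 < t)%N & isomorphic G (triangle_group r s t)].

Definition is_quotient (G H : groupType) : Prop :=
  exists f : {multiplicative G -> H}, forall h : H, exists g : G, f g = h.

(* Sets of finite groups are plain predicates: finGroupType is too large to be
   the carrier of a classical_sets.set.  *)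
Definition iso_class (H : finGroupType) : finGroupType -> Prop :=
  fun K => isomorphic H K.

Definition finite_quotients (G : groupType) : (finGroupType -> Prop) -> Prop :=
  fun C => exists2 H : finGroupType, is_quotient G H & C = iso_class H.

(* Main.v *)
From HB Require Import structures.
Require Import Defs.
From mathcomp Require Import all_boot fingroup.
From mathcomp Require Import all_order all_algebra all_fingroup cyclic center finfield ring.
From mathcomp Require Import boolp.

(** Write x for the three generators of the first triangle group, y for those of
    the second, and enlarge a common finite quotient until, for a given finite
    group W, every homomorphism from either triangle group to W factors through
    it (both groups have equally many such homomorphisms).  Take for W a wreath
    product F_p ~ G with p prime to all the periods, where x and y have images in
    G of orders equal to the periods; such a G comes from PGL_2 of a finite field.
    Counting the lifts of the map to G into V ><| G, for a submodule V of the
    functions G -> F_p, shows that the products of the numbers of fixed points in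
    V agree for x and y.  For V the functions invariant under right translation
    by K, this says that sum_i #(<x_i>\G/K) = sum_i #(<y_i>\G/K).  Hence the class
    function sum_i Ind_<x_i> 1 - sum_i Ind_<y_i> 1 is orthogonal to every Ind_K 1,
    in particular to itself, so it vanishes; summed over the elements of order m
    this determines sum_(m | n_i) 1/n_i for the periods n_i, for every m, and
    therefore the periods.  A period 1 makes the group cyclic of order g, the gcd
    of the two others, and (1, g, g) then replaces the periods. *)

Set Implicit Arguments.
Unset Strict Implicit.
Unset Printing Implicit Defensive.
Import Order.TTheory GRing.Theory Num.Theory.
Local Open Scope group_scope.
Local Open Scope ring_scope.

(** * Multisets of periods *)

Lemma sum_seq_count (R : pzSemiRingType) (B : nat) (P : pred nat) (F : nat -> R)
    (s : seq nat) :
    (forall x, x \in s -> (x < B)%N) ->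
  \sum_(x <- s | P x) F x = \sum_(j < B | P j) (count_mem (j : nat) s)%:R * F j.
Proof.
elim: s => [|x s IHs] sB.
  by rewrite big_nil big1 // => j _; rewrite mul0r.
have xB : (x < B)%N by apply: sB; rewrite mem_head.
rewrite big_cons IHs => [|y sy]; last by apply: sB; rewrite inE sy orbT.
under [in RHS]eq_bigr do rewrite /= natrD mulrDl.
rewrite big_split /=; case: ifPn => Px.
  congr (_ + _); rewrite (bigD1 (Ordinal xB)) //= eqxx mul1r big1 ?addr0 // => j.
  by case/andP=> _ /negPf jx; rewrite -val_eqE /= in jx; rewrite eq_sym jx mul0r.
rewrite [X in X + _]big1 ?add0r // => j Pj.
by case: eqP Px => [->|_ _]; rewrite ?Pj ?mul0r.
Qed.

(** Descending induction on [d]: once the multiplicities of all larger multiples of [d] agree, the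
    sums for [d] can differ only through the multiplicity of [d] itself. *)
Lemma perm_eq_harmonic (s t : seq nat) :
    (forall d : nat, (0 < d)%N ->
      \sum_(x <- s | (d %| x)%N) x%:R^-1 = \sum_(x <- t | (d %| x)%N) x%:R^-1 :> rat) ->
    0%N \notin s -> 0%N \notin t ->
  perm_eq s t.
Proof.
move=> st s0 t0.
pose B := (\max_(x <- s ++ t) x).+1.
have lt_B x : x \in s ++ t -> (x < B)%N by move=> xst; rewrite ltnS leq_bigmax_seq.
have sB x : x \in s -> (x < B)%N by move=> sx; rewrite lt_B // mem_cat sx.
have tB x : x \in t -> (x < B)%N by move=> tx; rewrite lt_B // mem_cat tx orbT.
(* The induction runs on [k], which bounds how far [d] lies below [B]; no entry of either list
   reaches [B]. *)
suff eq_count k d : (B <= d + k)%N -> (0 < d)%N -> count_mem d s = count_mem d t.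
  apply/allP => x xst /=; apply/eqP/(eq_count B); first exact: leq_addl.
  by case: x xst => //; rewrite mem_cat (negPf s0) (negPf t0).
elim: k d => [|k IHk] d Bd d_gt0.
  rewrite addn0 in Bd; have [sd td] : d \notin s /\ d \notin t.
    by split; apply/negP; [move/sB | move/tB]; rewrite ltnNge Bd.
  by rewrite (count_memPn sd) (count_memPn td).
have [dB|Bd'] := ltnP d B; last first.
  by apply: IHk; rewrite // (leq_trans Bd') ?leq_addr.
have := st d d_gt0; rewrite !(@sum_seq_count _ B) //.
rewrite (bigD1 (Ordinal dB)) //= [in RHS](bigD1 (Ordinal dB)) //=.
rewrite (@eq_bigr _ _ _ _ _ (fun j : 'I_B => (d %| j)%N && (j != Ordinal dB)) _
           (fun j : 'I_B => (count_mem (j : nat) t)%:R * (j : nat)%:R^-1)).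
  move/addIr/(mulIf _)/eqP; rewrite eqr_nat => H; apply/eqP/H.
  by rewrite invr_eq0 pnatr_eq0 -lt0n.
(* The index 0 is a multiple of [d] that the induction does not reach; its term vanishes because the
   inverse of 0 is 0. *)
move=> j /andP[dj jd]; have [j0|j_gt0] := posnP j; first by rewrite j0 invr0 !mulr0.
rewrite IHk //; have := dvdn_leq j_gt0 dj; rewrite leq_eqVlt.
rewrite -val_eqE /= eq_sym in jd; rewrite (negPf jd) /= => dj'.
by apply: leq_trans Bd _; rewrite addnS -addSn leq_add2r.
Qed.

(** * Double cosets and permutation characters of cyclic subgroups *)

Section DoubleCosets.
Variable gT : finGroupType.
Implicit Types (C K : {group gT}) (g h : gT).

Definition dcoset_act g (ck : gT * gT) := (ck.1^-1 * g * ck.2)%g.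

Fact dcoset_act1 : dcoset_act^~ 1%g =1 id.
Proof. by move=> g; rewrite /dcoset_act invg1 mul1g mulg1. Qed.

Fact dcoset_actM g : act_morph dcoset_act g.
Proof. by move=> [c k] [c' k']; rewrite /dcoset_act /= invMg !mulgA. Qed.

Canonical dcoset_action := TotalAction dcoset_act1 dcoset_actM.

Definition dcosets C K : {set {set gT}} := orbit dcoset_action (setX C K) @: setT.

Definition conj_count C g := #|[set h | (g ^ h)%g \in C]|.

Lemma conj_countJ C g h : conj_count C (g ^ h)%g = conj_count C g.
Proof.
rewrite /conj_count -(card_imset _ (mulgI h)); congr #|pred_of_set _|.
apply/setP=> k; apply/imsetP/idP => [[l]|].
  by rewrite !inE -conjgM => gl ->.
by rewrite inE => gk; exists (h^-1 * k)%g; rewrite ?inE -?conjgM mulKVg.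
Qed.

(* Frobenius reciprocity: up to the factor #|C|, conj_count C is the character
   induced from the trivial character of C. *)
Lemma sum_conj_count (R : comPzSemiRingType) C (f : gT -> R) :
    (forall g h, f (g ^ h)%g = f g) ->
  \sum_g (conj_count C g)%:R * f g = #|[set: gT]|%:R * \sum_(c in C) f c.
Proof.
move=> fJ.
transitivity (\sum_g \sum_(h | (g ^ h)%g \in C) f g).
  apply: eq_bigr => g _; rewrite sumr_const mulr_natl; congr (_ *+ _).
  by apply: eq_card => h; rewrite !inE.
rewrite (exchange_big_dep predT) //= mulr_natl -sumr_const.
apply: eq_big => [h|h _]; first by rewrite inE.
rewrite (reindex_inj (conjg_inj h^-1%g)) /=.
by apply: eq_big => [g|g _]; rewrite ?conjgKV // fJ.
Qed.

(** Cauchy-Frobenius orbit counting for the product of [C] and [K]: a pair [(c, k)] fixes [g]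
    exactly when [k = c ^ g], so summing over [k] counts the [g] that conjugate [c] into [K]. *)
Lemma card_dcosets C K :
  (#|dcosets C K| * (#|C| * #|K|) = \sum_(c in C) conj_count K c)%N.
Proof.
rewrite -cardsX /dcosets -Frobenius_Cauchy; last by apply/actsP => ? _ ?; rewrite !inE.
pose F c k := #|'Fix_([set: gT] | dcoset_action)[(c, k)]%g|.
rewrite (eq_bigr (fun ck => F ck.1 ck.2)); last by case.
rewrite (eq_bigl (fun ck => (ck.1 \in C) && (ck.2 \in K))); last first.
  by case=> c k; rewrite !inE.
rewrite -(pair_big (mem C) (mem K) F) /=; apply: eq_bigr => c _.
transitivity (\sum_(k in K) \sum_(g | (c ^ g)%g == k) 1)%N.
  apply: eq_bigr => k _; rewrite sum1_card; apply: eq_card => g.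
  rewrite !inE sub1set inE /= /dcoset_act /= unfold_in /= conjgE.
  have cgK : (c^-1 * g * (g^-1 * (c * g)) = g)%g by rewrite !mulgA mulgK mulVg mul1g.
  by apply/eqP/eqP=> [H|<- //]; apply: (mulgI (c^-1 * g)%g); rewrite H.
rewrite (exchange_big_dep predT) //= /conj_count -sum1_card.
under eq_bigr => g _.
  rewrite (eq_bigl (fun k => (k == c ^ g)%g && (k \in K))); last first.
    by move=> k; rewrite andbC eq_sym.
  over.
rewrite [RHS](eq_bigl (fun g => (c ^ g)%g \in K)); last by move=> g; rewrite inE.
rewrite [RHS]big_mkcond /=; apply: eq_bigr => g _.
by case: ifP => cgK; rewrite big_mkcondr big_pred1_eq cgK.
Qed.
End DoubleCosets.

(** An invariant function is a free choice of one value per orbit. *)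
Lemma card_act_invariant (aT : finGroupType) (rT A : finType) (a0 : A)
    (to : {action aT &-> rT}) (D : {group aT}) :
  #|[set u : {ffun rT -> A} | [forall x, forall d in D, u (to x d) == u x]]| =
    (#|A| ^ #|orbit to D @: setT|)%N.
Proof.
rewrite -(card_pffun_on a0 _ predT).
(* Choices are encoded as functions on all sets of points that equal the default [a0] off the
   orbits, so that each choice is counted once. *)
pose lift (F : {ffun {set rT} -> A}) := [ffun x => F (orbit to D x)].
rewrite -(card_in_imset (f := lift)).
  congr #|pred_of_set _|; apply/setP=> u; rewrite inE.
  apply/idP/imsetP => [/forallP uD|[F _ ->]]; last first.
    apply/forallP=> x; apply/forall_inP=> d Dd; rewrite !ffunE.
    by rewrite (orbit_act _ _ Dd).
  pose F : {ffun {set rT} -> A} :=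
    [ffun O : {set rT} => if [pick x in O | O == orbit to D x] is Some x then u x else a0].
  have Forb x : F (orbit to D x) = u x.
    rewrite ffunE; case: pickP => [y /andP[_ /eqP Oxy]|/(_ x)]; last first.
      by rewrite orbit_refl eqxx.
    have: y \in orbit to D x by rewrite Oxy orbit_refl.
    by case/orbitP=> d Dd <-; apply/eqP; have /forall_inP/(_ d Dd) := uD x.
  exists F; last by apply/ffunP=> x; rewrite ffunE Forb.
  apply/pffun_onP; split=> //; apply/supportP=> O Oorb; rewrite ffunE.
  case: pickP => // x /andP[_ /eqP Ox]; case/imsetP: Oorb.
  by exists x; rewrite // inE.
move=> F F' /pffun_onP[/supportP F0 _] /pffun_onP[/supportP F'0 _] /ffunP FF'.
apply/ffunP=> O; have [/imsetP[x _ ->]|Oorb] := boolP (O \in orbit to D @: setT).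
  by have := FF' x; rewrite !ffunE.
by rewrite F0 ?F'0.
Qed.

Section CyclicCharacters.
Variables (gT : finGroupType) (I : finType) (x y : I -> gT).

Hypothesis xy_dcosets : forall K : {group gT},
  (\sum_i #|dcosets <[x i]> K| = \sum_i #|dcosets <[y i]> K|)%N.

Let e (C : {group gT}) g : rat := (conj_count C g)%:R / #|C|%:R.

Let eJ C g h : e C (g ^ h)%g = e C g.
Proof. by rewrite /e conj_countJ. Qed.

Let sum_e (f : gT -> rat) C : (forall g h, f (g ^ h)%g = f g) ->
  \sum_g e C g * f g = #|[set: gT]|%:R * (\sum_(c in C) f c) / #|C|%:R.
Proof.
move=> fJ; rewrite -sum_conj_count // mulr_suml.
by apply: eq_bigr => g _; rewrite mulrAC.
Qed.

(** Mackey's formula: up to the factor [#|[set: gT]|], the left side is the inner product of the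
    characters induced from the trivial characters of [C] and [K]. *)
Let sum_ee C K : \sum_g e C g * e K g = (#|[set: gT]| * #|dcosets C K|)%:R.
Proof.
rewrite sum_e; last exact: eJ.
rewrite natrM -mulrA; congr (_ * _); rewrite -mulr_suml -natr_sum -card_dcosets.
by rewrite mulnA 2!natrM mulfK ?mulfK // pnatr_eq0 -lt0n cardG_gt0.
Qed.

Let d g := \sum_i e <[x i]>%G g - \sum_i e <[y i]>%G g.

Let sum_de K : \sum_g d g * e K g = 0.
Proof.
under eq_bigr do rewrite mulrBl !mulr_suml.
rewrite sumrB exchange_big [X in _ - X]exchange_big /=.
rewrite !(eq_bigr _ (fun i _ => sum_ee _ _)) -!natr_sum -!big_distrr /=.
by rewrite xy_dcosets subrr.
Qed.

(** [d] is a combination of functions [e K], all orthogonal to it, so its sum of squares vanishes;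
    its values are rational, so each is 0. *)
Let d0 g : d g = 0.
Proof.
suff: \sum_g d g ^+ 2 == 0.
  rewrite psumr_eq0 => [/allP/(_ g)|h _]; last exact: sqr_ge0.
  by rewrite mem_index_enum sqrf_eq0 => /(_ isT)/eqP.
under eq_bigr do rewrite expr2 {2}/d mulrBr !mulr_sumr.
rewrite sumrB exchange_big [X in _ - X]exchange_big /=.
by rewrite !big1 ?subrr // => i _; apply: sum_de.
Qed.

Lemma perm_eq_orders : perm_eq [seq #[x i] | i : I] [seq #[y i] | i : I].
Proof.
apply: perm_eq_harmonic; last 2 first.
- by apply/mapP => -[i _ /eqP]; rewrite eq_sym -leqn0 leqNgt order_gt0.
- by apply/mapP => -[i _ /eqP]; rewrite eq_sym -leqn0 leqNgt order_gt0.
move=> m m_gt0.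
pose f (g : gT) : rat := (#[g] == m)%:R.
have fJ g h : f (g ^ h)%g = f g by rewrite /f orderJ.
have sum_f h : \sum_(c in <[h]>) f c = if (m %| #[h])%N then (totient m)%:R else 0.
  transitivity (#|[set c in <[h]> | #[c] == m]|%:R : rat).
    rewrite -sum1_card natr_sum big_mkcond [RHS]big_mkcond /=; apply: eq_bigr => c _.
    by rewrite !inE /f; case: ifP => //= _; case: eqP.
  case: ifPn => [m_h|mNh].
    (* The elements of order [m] in [<[h]>] are the generators of its only subgroup of order [m]. *)
    congr (_%:R); have oh : #[h ^+ (#[h] %/ m)]%g = m.
      by rewrite orderXdiv ?divnA ?mulKn ?dvdn_div // order_gt0.
    rewrite -{2}oh totient_gen; apply: eq_card => c; rewrite !inE /generator.
    have hm_h : <[h ^+ (#[h] %/ m)]>%g \subset <[h]> by apply: cycleX.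
    have [ch|cNh] := boolP (c \in <[h]>).
      rewrite eq_sym (eq_subG_cyclic (cycle_cyclic h)) ?cycle_subG ?mem_cycle //.
      by rewrite -!orderE oh eq_sym.
    by apply/esym/negP => /eqP chm; rewrite -cycle_subG -chm hm_h in cNh.
  rewrite (_ : [set c in _ | _] = set0) ?cards0 //; apply/setP=> c; rewrite !inE.
  apply/negP => /andP[ch /eqP cm]; case/negP: mNh.
  by rewrite -cm order_dvdG.
have sum_orders (z : I -> gT) :
    \sum_i \sum_g e <[z i]>%G g * f g =
    (#|[set: gT]| * totient m)%:R *
      \sum_(n <- [seq #[z i] | i : I] | (m %| n)%N) n%:R^-1.
  rewrite big_map big_enum_cond /= mulr_sumr [RHS]big_mkcond /=.
  apply: eq_bigr => i _; rewrite sum_e // sum_f natrM -!mulrA -orderE.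
  by case: ifP => //; rewrite mul0r mulr0.
have: \sum_g d g * f g = 0 by rewrite big1 // => g _; rewrite d0 mul0r.
under eq_bigr do rewrite mulrBl !mulr_suml.
rewrite sumrB exchange_big [X in _ - X]exchange_big /= !sum_orders.
move/eqP; rewrite subr_eq0 => /eqP/mulfI; apply.
by rewrite pnatr_eq0 muln_eq0 negb_or -!lt0n totient_gt0 m_gt0 cardG_gt0.
Qed.
End CyclicCharacters.

(** * Wreath products and their cocycles *)

(** The fibre in [S] over each point of the image is a translate of the kernel. *)
Lemma card_fibers (U V : finZmodType) (f : U -> V) (S : {set U}) :
    zmod_closed (mem S) -> {morph f : x y / x - y} ->
  #|S| = (#|f @: S| * #|[set u in S | f u == 0%R]|)%N.
Proof.
move=> [S0 SB] fB; rewrite -sum1_card (partition_big_imset f) /= -sum_nat_const.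
apply: eq_bigr => _ /imsetP[x Sx ->]; rewrite sum1_card.
have f0 : f 0 = 0 by rewrite -(subrr 0) fB subrr.
have fN y : f (- y) = - f y by rewrite -sub0r fB f0 sub0r.
have SN y : y \in S -> - y \in S by move=> Sy; rewrite -sub0r SB.
have SD y z : y \in S -> z \in S -> y + z \in S.
  by move=> Sy Sz; rewrite -(opprK z) SB // SN.
rewrite -[in RHS](card_imset _ (addIr x)); apply: eq_card => y.
rewrite unfold_in /=; apply/andP/imsetP => [[Sy /eqP fyx]|[z]].
  by exists (y - x); rewrite ?subrK // inE SB // fB fyx subrr eqxx.
rewrite inE => /andP[Sz /eqP fz] ->; split; first exact: SD.
by rewrite -{1}(opprK x) fB fN fz sub0r opprK.
Qed.

HB.instance Definition _ (I : finType) (A : finZmodType) :=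
  GRing.Zmodule.on {ffun I -> A}.

Definition i0 : 'I_3 := inord 0.
Definition i1 : 'I_3 := inord 1.
Definition i2 : 'I_3 := inord 2.

Lemma ord3P (P : 'I_3 -> Prop) : P i0 -> P i1 -> P i2 -> forall i, P i.
Proof.
move=> P0 P1 P2 [[|[|[|//]]] lti].
- by rewrite (_ : Ordinal lti = i0) //; apply/val_inj; rewrite /= inordK.
- by rewrite (_ : Ordinal lti = i1) //; apply/val_inj; rewrite /= inordK.
- by rewrite (_ : Ordinal lti = i2) //; apply/val_inj; rewrite /= inordK.
Qed.

(** Such triples are the images of the generators under the homomorphisms to [G] from the triangle
    group with periods [n]; the orders of the entries need only divide the periods. *)
Definition triangle_triple (G : groupType) (n : 'I_3 -> nat) (g : 'I_3 -> G) :=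
  (g i0 * g i1 * g i2 == 1)%g && [forall i, (g i ^+ n i == 1)%g].

Section Wreath.
Variables (A : finZmodType) (G : finGroupType).
Local Notation M := {ffun G -> A}.

Definition shift (a : G) (u : M) : M := [ffun g => u (a^-1 * g)%g].

Lemma shiftB a : {morph shift a : u v / u - v}.
Proof. by move=> u v; apply/ffunP=> g; rewrite !ffunE. Qed.

HB.instance Definition _ a :=
  GRing.isZmodMorphism.Build M M (shift a) (@shiftB a).

Lemma shift1 u : shift 1%g u = u.
Proof. by apply/ffunP=> g; rewrite ffunE invg1 mul1g. Qed.

Lemma shiftM a b u : shift (a * b)%g u = shift a (shift b u).
Proof. by apply/ffunP=> g; rewrite !ffunE invMg mulgA. Qed.

(* (u, g) is the translation by u composed with the shift by g. *)
Definition wreath : Type := (M * G)%type.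
HB.instance Definition _ := Finite.on wreath.

Definition wreath_one : wreath := (0, 1%g).
Definition wreath_mul (p q : wreath) : wreath :=
  (p.1 + shift p.2 q.1, (p.2 * q.2)%g).
Definition wreath_inv (p : wreath) : wreath :=
  (- shift p.2^-1%g p.1, p.2^-1%g).

Fact wreath_mulA : associative wreath_mul.
Proof.
by move=> p q r; rewrite /wreath_mul /= raddfD /= shiftM addrA mulgA.
Qed.

Fact wreath_mul1 : left_id wreath_one wreath_mul.
Proof. by move=> [u a]; rewrite /wreath_mul /= shift1 add0r mul1g. Qed.

Fact wreath_mulV : left_inverse wreath_one wreath_inv wreath_mul.
Proof. by move=> p; rewrite /wreath_mul /= addNr mulVg. Qed.

HB.instance Definition _ :=
  Finite_isGroup.Build wreath wreath_mulA wreath_mul1 wreath_mulV.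

Lemma wreath_expg (u : M) (a : G) n :
  (((u, a) : wreath) ^+ n)%g = (\sum_(k < n) shift (a ^+ k)%g u, (a ^+ n)%g) :> wreath.
Proof.
elim: n => [|n IHn]; first by rewrite big_ord0 !expg0.
by rewrite big_ord_recr expgSr IHn expgSr.
Qed.

End Wreath.

Section Cocycles.
Variables (A : finZmodType) (G : finGroupType) (p : nat).
Local Notation M := {ffun G -> A}.
Variable V : {set M}.
Hypothesis pM : forall u : M, u *+ p = 0.
Hypothesis V_zmod : zmod_closed (mem V).
Hypothesis V_shift : forall a u, u \in V -> shift a u \in V.

Let V0 : 0 \in V := proj1 V_zmod.
Let VB u v : u \in V -> v \in V -> u - v \in V. Proof. by case: V_zmod => _; apply. Qed.
Let VD u v : u \in V -> v \in V -> u + v \in V.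
Proof. by move=> Vu Vv; rewrite -(opprK v) VB // -sub0r VB. Qed.
Let Vsum (I : finType) (P : pred I) (F : I -> M) :
  (forall i, P i -> F i \in V) -> \sum_(i | P i) F i \in V.
Proof. by move=> VF; elim/big_rec: _ => // i u Pi; apply: VD; apply: VF. Qed.

(** The value at [a] of the principal crossed homomorphism given by [u]. *)
Definition diff (a : G) (u : M) := u - shift a u.

Lemma diffB a : {morph diff a : u v / u - v}.
Proof. by move=> u v; rewrite /diff raddfB /= !opprD !opprK addrACA. Qed.

Let Vdiff a u : u \in V -> diff a u \in V.
Proof. by move=> Vu; rewrite VB // V_shift. Qed.

Let sum_shift_diff a r m :
  \sum_(k < r) shift (a ^+ k)%g (diff a m) = m - shift (a ^+ r)%g m.
Proof.
elim: r => [|r IHr]; first by rewrite big_ord0 expg0 shift1 subrr.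
by rewrite big_ord_recr /= IHr /diff raddfB /= -shiftM -expgSr addrA subrK.
Qed.

Let diff_sum_shift a r u :
  diff a (\sum_(k < r) shift (a ^+ k)%g u) = u - shift (a ^+ r)%g u.
Proof.
rewrite -sum_shift_diff /diff raddf_sum /= -sumrB; apply: eq_bigr => k _.
by rewrite raddfB /= -!shiftM -expgSr -expgS.
Qed.

(* H^1 of a cyclic group of order prime to p vanishes on V. *)
Lemma cocycle_coboundary a r u :
    (0 < r)%N -> coprime r p -> (a ^+ r = 1)%g -> u \in V ->
  reflect (exists2 m, m \in V & u = diff a m) (\sum_(k < r) shift (a ^+ k)%g u == 0).
Proof.
move=> r_gt0 co_rp ar Vu; apply: (iffP eqP) => [Nu|[m Vm ->]]; last first.
  by rewrite sum_shift_diff ar shift1 subrr.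
have [s t st _] := egcdnP p r_gt0; rewrite (eqP co_rp) in st.
(* The inner sum is the value at [a ^+ k] of the cocycle sending [a] to [u]. Summing these values
   over the cyclic group gives an [m] with coboundary [u *+ r]; the factor [s], inverse to [r]
   modulo [p], then divides by [r]. *)
pose m := \sum_(k < r) \sum_(j < k) shift (a ^+ j)%g u.
exists (\sum_(i < s) m).
  by do 3![apply: Vsum => ? _]; apply: V_shift.
have diff_m : diff a m = u *+ r.
  transitivity (\sum_(k < r) (u - shift (a ^+ k)%g u)).
    rewrite /m /diff raddf_sum -sumrB; apply: eq_bigr => k _; exact: diff_sum_shift.
  by rewrite sumrB Nu subr0 sumr_const card_ord.
rewrite sumr_const card_ord /diff raddfMn -mulrnBl /= -/(diff a m) diff_m -mulrnA.
by rewrite mulnC st mulrnDr mulnC mulrnA pM mul0rn add0r.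
Qed.

Variables (a : 'I_3 -> G).
Hypothesis a_prod : (a i0 * a i1 * a i2 = 1)%g.
Implicit Type m : {ffun 'I_3 -> M}.

Definition families : {set {ffun 'I_3 -> M}} :=
  [set m : {ffun 'I_3 -> M} | [forall i, m i \in V]].

(* This is the Fox derivative of the word xyz, evaluated on the family of
   coboundaries diff (a i) (m i). *)
Definition boundary m : M :=
  diff (a i0) (m i0) + shift (a i0) (diff (a i1) (m i1))
    + shift (a i0 * a i1)%g (diff (a i2) (m i2)).

(** The 1-cocycles with values in [V], recorded by their values on the three generators;
    equivalently the lifts of [a] to triangle triples of the semidirect product of [V] and [G]. *)
Definition cocycles (n : 'I_3 -> nat) : {set {ffun 'I_3 -> M}} :=
  [set u : {ffun 'I_3 -> M} in families | triangle_triple n (fun i => (u i, a i) : wreath A G)].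

Definition invariants (g : G) : {set M} := [set u in V | shift g u == u].

Lemma familiesP m : reflect (forall i, m i \in V) (m \in families).
Proof. by rewrite inE; apply: forallP. Qed.

Lemma families_zmod : zmod_closed (mem families).
Proof.
split=> [|m m' /familiesP Vm /familiesP Vm']; apply/familiesP=> i; rewrite !ffunE //.
exact: VB.
Qed.

Lemma boundaryB : {morph boundary : m m' / m - m'}.
Proof.
move=> m m'; rewrite /boundary !ffunE !diffB (raddfB (shift (a i0))).
have sub3 (x x' y y' z z' : M) :
    (x - x') + (y - y') + (z - z') = (x + y + z) - (x' + y' + z').
  by rewrite !opprD [X in X + _ = _]addrACA [LHS]addrACA.
by rewrite (raddfB (shift (a i0 * a i1)%g)) sub3.
Qed.

Lemma card_families : #|families| = (#|V| ^ 3)%N.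
Proof.
rewrite -[in RHS](card_ord 3) -card_ffun_on; apply: eq_card => m.
by apply/familiesP/ffun_onP.
Qed.

Lemma triangle_triple_wreath n u : (forall i, a i ^+ n i = 1)%g ->
  triangle_triple n (fun i => (u i, a i) : wreath A G) =
  (u i0 + shift (a i0) (u i1) + shift (a i0 * a i1)%g (u i2) == 0) &&
  [forall i, \sum_(k < n i) shift (a i ^+ k)%g (u i) == 0].
Proof.
move=> an; rewrite /triangle_triple; congr (_ && _).
  by rewrite -pair_eqE /= a_prod eqxx andbT.
by apply: eq_forallb => i; rewrite wreath_expg -pair_eqE /= an eqxx andbT.
Qed.

(** By [cocycle_coboundary] the power relations say, for each [i] separately, that [u i] is a
    coboundary at [a i]; the product relation then reads [boundary m = 0]. *)
Lemma cocyclesP n u : (forall i, 0 < n i)%N -> (forall i, coprime (n i) p) ->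
    (forall i, a i ^+ n i = 1)%g ->
  reflect (exists2 m, m \in families & boundary m = 0 /\ u = [ffun i => diff (a i) (m i)])
    (u \in cocycles n).
Proof.
move=> n_gt0 co_n an; rewrite inE triangle_triple_wreath //.
apply: (iffP and3P) => [[/familiesP Vu /eqP u_prod /forallP u_pow]|[m /familiesP Vm [bm ->]]].
  have um i : exists v : M, (v \in V) && (u i == diff (a i) v).
    have /cocycle_coboundary[//|//|//|//|v Vv ->] := u_pow i.
    by exists v; rewrite Vv eqxx.
  have [v mP] := fin_all_exists um; pose m' := [ffun i => v i].
  exists m'; first by apply/familiesP=> i; rewrite ffunE; case/andP: (mP i).
  have um' : u = [ffun i => diff (a i) (m' i)].
    by apply/ffunP=> i; rewrite !ffunE; case/andP: (mP i) => _ /eqP.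
  by split=> //; rewrite -u_prod um' /boundary !ffunE.
split.
- by apply/familiesP=> i; rewrite ffunE Vdiff.
- by rewrite !ffunE -/(boundary m) bm.
apply/forallP=> i; apply/cocycle_coboundary; rewrite ?ffunE ?Vdiff //.
by exists (m i).
Qed.

(** [card_fibers] is used twice: for [boundary] on all families, then for the coboundary map [d] on
    the kernel of [boundary], whose image is the set of cocycles and whose kernel is the product of
    the invariants. *)
Lemma card_cocycles n : (forall i, 0 < n i)%N -> (forall i, coprime (n i) p) ->
    (forall i, a i ^+ n i = 1)%g ->
  (#|V| ^ 3 = #|boundary @: families| * (#|cocycles n| * \prod_i #|invariants (a i)|))%N.
Proof.
move=> n_gt0 co_n an; rewrite -card_families (card_fibers families_zmod boundaryB).
congr (_ * _)%N; pose K := [set m in families | boundary m == 0].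
pose d m : {ffun 'I_3 -> M} := [ffun i => diff (a i) (m i)].
have dB : {morph d : m m' / m - m'}.
  by move=> m m'; apply/ffunP=> i; rewrite !ffunE diffB.
have KE m : (m \in K) = (m \in families) && (boundary m == 0) by rewrite inE.
have K_zmod : zmod_closed (mem K).
  have b0 : boundary 0 = 0 by rewrite -(subrr 0) boundaryB subrr.
  case: families_zmod => S0 SB; split=> [|m m']; first by rewrite KE S0 b0 eqxx.
  rewrite ![_ \in mem K]KE => /andP[Sm /eqP bm] /andP[Sm' /eqP bm'].
  by rewrite (SB m m' Sm Sm') boundaryB bm bm' subrr eqxx.
rewrite (card_fibers K_zmod dB); congr (_ * _)%N.
  apply: eq_card => u; apply/imsetP/cocyclesP => // -[m].
    by rewrite KE => /andP[Sm /eqP bm] ->; exists m.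
  by move=> Sm [bm ->]; exists m; rewrite // KE Sm bm eqxx.
rewrite -(cardsXn (fun i => invariants (a i))); apply: eq_card => m.
rewrite in_setXn inE KE.
apply/andP/forallP => [[/andP[/familiesP Vm _] /eqP/ffunP dm] i|m_inv].
  by rewrite inE Vm eq_sym -subr_eq0; have := dm i; rewrite !ffunE /diff => ->; rewrite eqxx.
have dm i : diff (a i) (m i) = 0.
  by have := m_inv i; rewrite inE => /andP[_ /eqP mi]; rewrite /diff mi subrr.
split; last by apply/eqP/ffunP=> i; rewrite !ffunE dm.
apply/andP; split; last by rewrite /boundary !dm !raddf0 !addr0.
by apply/familiesP => i; have := m_inv i; rewrite inE => /andP[].
Qed.
End Cocycles.

(* The image is the span of all g v - v with v in V and g in the group generated
   by the a i, and so depends on that group only. *)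
Lemma boundary_image_sub (A : finZmodType) (G : finGroupType)
    (V : {set {ffun G -> A}}) (a b : 'I_3 -> G) :
    zmod_closed (mem V) -> (forall g u, u \in V -> shift g u \in V) ->
    (forall j, b j \in <<a @: setT>>%g) ->
  boundary b @: families V \subset boundary a @: families V.
Proof.
move=> V_zmod V_shift b_gen; set J := boundary a @: _.
have [V0 VB] := V_zmod.
have VN u : u \in V -> - u \in V by move=> Vu; rewrite -sub0r VB.
have VD u v : u \in V -> v \in V -> u + v \in V.
  by move=> Vu Vv; rewrite -(opprK v) VB // VN.
have Vdiff g u : u \in V -> diff g u \in V by move=> Vu; rewrite VB // V_shift.
have Jb u v w : u \in V -> v \in V -> w \in V ->
    diff (a i0) u + shift (a i0) (diff (a i1) v)
    + shift (a i0 * a i1)%g (diff (a i2) w) \in J.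
  move=> Vu Vv Vw; apply/imsetP; exists [ffun i : 'I_3 => [:: u; v; w]`_i].
    by apply/familiesP; apply: ord3P; rewrite ffunE /= inordK.
  by rewrite /boundary !ffunE /= !inordK.
have JV u : u \in J -> u \in V.
  case/imsetP=> m /familiesP Vm ->; rewrite /boundary.
  by apply: (VD); [apply: (VD); last apply: (V_shift) | apply: (V_shift)]; apply: (Vdiff).
have JB u v : u \in J -> v \in J -> u - v \in J.
  have [_ SB] := families_zmod V_zmod.
  move=> /imsetP[m Sm ->] /imsetP[m' Sm' ->]; rewrite -boundaryB.
  by apply: imset_f; apply: SB.
have J0 : 0 \in J.
  by have /JB/(_ (Jb _ _ _ V0 V0 V0)) := Jb _ _ _ V0 V0 V0; rewrite subrr.
have JD u v : u \in J -> v \in J -> u + v \in J.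
  by move=> Ju Jv; rewrite -(opprK v) JB // -sub0r JB.
(* The elements whose coboundaries all lie in [J] form a subgroup; it contains every [a i], hence
   every [b j]. *)
pose P := [set g | [forall (v | v \in V), diff g v \in J]].
have PP g : reflect (forall v, v \in V -> diff g v \in J) (g \in P).
  by rewrite inE; apply: forall_inP.
have P_shift g u : g \in P -> u \in J -> shift g u \in J.
  move=> /PP Pg Ju; rewrite (_ : shift g u = u - diff g u).
    by rewrite JB ?Pg ?JV.
  by rewrite /diff opprB addrC subrK.
have diffM g h u : diff (g * h)%g u = diff g u + shift g (diff h u).
  by rewrite /diff raddfB /= shiftM addrA subrK.
have P_group : group_set P.
  apply/group_setP; split=> [|g h Pg Ph]; apply/PP=> v Vv.
    by rewrite /diff shift1 subrr.
  by rewrite diffM JD ?(P_shift g) //; [apply/(PP g) | apply/(PP h)].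
have diff0 g : diff g 0 = 0 :> {ffun G -> A} by rewrite /diff raddf0 subrr.
have Pa0 : a i0 \in P.
  by apply/PP=> v Vv; have := Jb _ _ _ Vv V0 V0; rewrite !diff0 !raddf0 !addr0.
have P_of_shift g h : g \in P -> (forall v, v \in V -> shift g (diff h v) \in J) -> h \in P.
  move=> /PP Pg gh; apply/PP=> v Vv.
  by rewrite -(subrK (shift g (diff h v)) (diff h v)) JD ?gh ?Pg ?Vdiff.
(* A family supported at one index contributes a shifted coboundary, and the shift is by an element
   already known to lie in [P]. *)
have Pa1 : a i1 \in P.
  apply: (P_of_shift _ _ Pa0) => v Vv.
  by have := Jb _ _ _ V0 Vv V0; rewrite !diff0 !raddf0 add0r !addr0.
have aP j : a j \in P.
  elim/ord3P: j => //; apply: (P_of_shift (a i0 * a i1)%g) => [|v Vv].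
    exact: (groupM (G := group P_group)).
  by have := Jb _ _ _ V0 V0 Vv; rewrite !diff0 !raddf0 !add0r.
have genP : <<a @: setT>> \subset P.
  by rewrite (gen_subG _ (group P_group)); apply/subsetP=> _ /imsetP[j _ ->].
have bP j : b j \in P by apply: (subsetP genP).
apply/subsetP=> _ /imsetP[m /familiesP Vm ->]; rewrite /boundary.
have Pb01 : (b i0 * b i1)%g \in P by apply: (groupM (G := group P_group)).
have Jd j v : v \in V -> diff (b j) v \in J by move: v; apply/PP.
by apply: (JD); [apply: (JD); last apply: (P_shift) | apply: (P_shift)]; rewrite ?Jd.
Qed.

Lemma morph_one (G H : groupType) (f : G -> H) :
  {morph f : a b / (a * b)%g} -> f 1%g = 1%g.
Proof. by move=> fM; apply: (mulgI (f 1%g)); rewrite -fM !mulg1. Qed.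

Lemma morph_expg (G H : groupType) (f : G -> H) g n :
  {morph f : a b / (a * b)%g} -> f (g ^+ n)%g = (f g ^+ n)%g.
Proof.
move=> fM; elim: n => [|n IHn]; first by rewrite !expg0 morph_one.
by rewrite !expgS fM IHn.
Qed.

Lemma eq_triangle_triple (G : groupType) n (g h : 'I_3 -> G) :
  g =1 h -> triangle_triple n g = triangle_triple n h.
Proof.
by move=> gh; rewrite /triangle_triple !gh; under eq_forallb => i do rewrite gh.
Qed.

Lemma triangle_triple_morph (G H : groupType) (f : G -> H) n g :
    {morph f : a b / (a * b)%g} -> triangle_triple n g ->
  triangle_triple n (fun i => f (g i)).
Proof.
move=> fM /andP[/eqP g_prod /forallP gn]; apply/andP; split.
  by rewrite -!fM g_prod (morph_one fM).
by apply/forallP=> i; rewrite -morph_expg // (eqP (gn i)) (morph_one fM).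
Qed.

Lemma eq_morph_gen (Q : finGroupType) (H : groupType) (f h : Q -> H) (X : {set Q}) :
    {morph f : a b / (a * b)%g} -> {morph h : a b / (a * b)%g} ->
    <<X>>%g = setT -> {in X, f =1 h} -> f =1 h.
Proof.
move=> fM hM X_gen fh q.
pose P := [set q | f q == h q].
have P_group : group_set P.
  apply/group_setP; split=> [|a b]; first by rewrite inE (morph_one fM) (morph_one hM).
  by rewrite !inE fM hM => /eqP-> /eqP->.
have: <<X>>%g \subset P.
  by rewrite (gen_subG _ (group P_group)); apply/subsetP=> a Xa; rewrite inE fh.
by move/subsetP/(_ q); rewrite X_gen !inE => /(_ isT)/eqP.
Qed.

(** When [x] is the image of the generators, this says that every homomorphism to [W] from the
    triangle group with periods [n] factors through [Q]. *)
Definition universal_for (Q W : groupType) (n : 'I_3 -> nat) (x : 'I_3 -> Q) :=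
  forall w : 'I_3 -> W, triangle_triple n w ->
  exists2 h : Q -> W, {morph h : a b / (a * b)%g} & h \o x =1 w.

(** * Comparing two generating triples of one finite group *)

Section Comparison.
Variables (A : finZmodType) (p : nat) (Q G : finGroupType) (rho : Q -> G).
Local Notation M := {ffun G -> A}.
Local Notation W := (wreath A G).
Hypothesis pM : forall u : M, u *+ p = 0.
Hypothesis rhoM : {morph rho : a b / (a * b)%g}.

Section OneSided.
Variables (V : {set M}) (m n : 'I_3 -> nat) (x y : 'I_3 -> Q).
Hypothesis V_zmod : zmod_closed (mem V).
Hypothesis V_shift : forall a u, u \in V -> shift a u \in V.
Hypotheses (x_gen : <<x @: setT>>%g = setT) (y_gen : <<y @: setT>>%g = setT).
Hypotheses (x_fact : universal_for W m x) (ny : triangle_triple n y).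

(** A cocycle over [x] is the restriction of a homomorphism from [Q] to the wreath product lying
    above [rho]. Its values at [y] give a cocycle over [y], which determines the homomorphism
    because [y] generates [Q]. *)
Lemma leq_card_cocycles :
  (#|cocycles V (rho \o x) m| <= #|cocycles V (rho \o y) n|)%N.
Proof.
have [V0 VB] := V_zmod.
have VN u : u \in V -> - u \in V by move=> Vu; rewrite -sub0r VB.
have VD u v : u \in V -> v \in V -> u + v \in V.
  by move=> Vu Vv; rewrite -(opprK v) VB // VN.
have lift_ex (u : {ffun 'I_3 -> M}) : exists v : {ffun 'I_3 -> M},
    u \in cocycles V (rho \o x) m ->
    v \in cocycles V (rho \o y) n /\
    exists h : Q -> W, [/\ {morph h : a b / (a * b)%g},
      (forall i, h (x i) = (u i, rho (x i))) & (forall i, h (y i) = (v i, rho (y i)))].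
  have [|_] := boolP (u \in _); last by exists 0.
  rewrite inE => /andP[/familiesP Vu /x_fact[h hM hx]].
  have h_rho q : (h q).2 = rho q.
    apply: (@eq_morph_gen _ _ (fun q => (h q).2) rho (x @: setT)) => // [a b|].
      by rewrite hM.
    by move=> _ /imsetP[i _ ->]; have /= -> := hx i.
  have h_V q : (h q).1 \in V.
    pose P := [set q | (h q).1 \in V].
    have P_group : group_set P.
      apply/group_setP; split=> [|a b]; first by rewrite inE (morph_one hM).
      by rewrite !inE hM => Va Vb; apply: (VD); last apply: (V_shift).
    have: <<x @: setT>>%g \subset P.
      rewrite (gen_subG _ (group P_group)); apply/subsetP=> _ /imsetP[i _ ->].
      by rewrite inE; have /= -> := hx i; apply: Vu.
    by rewrite x_gen => /subsetP/(_ q); rewrite !inE; apply.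
  have hy i : h (y i) = ((h (y i)).1, rho (y i)) by rewrite -h_rho -surjective_pairing.
  exists [ffun i => (h (y i)).1] => _; split.
    rewrite inE; apply/andP; split; first by apply/familiesP=> i; rewrite ffunE.
    rewrite -(eq_triangle_triple n (g := h \o y)) ?(triangle_triple_morph hM ny) //.
    by move=> i; rewrite /= hy ffunE.
  by exists h; split=> // i; rewrite ffunE.
have [f fP] := fin_all_exists lift_ex.
rewrite -(card_in_imset (f := f)); last first.
  move=> u v /fP[_ [h [hM hx hy]]] /fP[_ [k [kM kx ky]]] fuv.
  have hk : h =1 k.
    apply: (eq_morph_gen hM kM y_gen) => _ /imsetP[i _ ->].
    by rewrite hy ky fuv.
  by apply/ffunP=> i; have := hx i; rewrite hk kx => -[].
by apply/subset_leq_card/subsetP=> _ /imsetP[u /fP[fu _] ->].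
Qed.
End OneSided.

Variables (m n : 'I_3 -> nat) (x y : 'I_3 -> Q).
Hypotheses (x_gen : <<x @: setT>>%g = setT) (y_gen : <<y @: setT>>%g = setT).
Hypotheses (x_fact : universal_for W m x) (y_fact : universal_for W n y).
Hypotheses (mx : triangle_triple m x) (ny : triangle_triple n y).
Hypotheses (m_gt0 : forall i, (0 < m i)%N) (n_gt0 : forall i, (0 < n i)%N).
Hypotheses (co_m : forall i, coprime (m i) p) (co_n : forall i, coprime (n i) p).

(** Both triples generate the same image under [rho], so the images of [boundary] coincide; the
    cocycle counts agree by [leq_card_cocycles] in both directions. Cancelling these positive
    factors in [card_cocycles] leaves the invariants. *)
Lemma prod_card_invariants (V : {set M}) :
    zmod_closed (mem V) -> (forall a u, u \in V -> shift a u \in V) ->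
  (\prod_i #|invariants V (rho (x i))| = \prod_i #|invariants V (rho (y i))|)%N.
Proof.
move=> V_zmod V_shift.
have triple_rho k z : triangle_triple k z ->
    (rho (z i0) * rho (z i1) * rho (z i2) = 1)%g /\ forall i, (rho (z i) ^+ k i = 1)%g.
  move/(triangle_triple_morph rhoM)=> /andP[/eqP ? /forallP kz].
  by split=> // i; apply/eqP.
have [[x_prod xm] [y_prod yn]] := (triple_rho _ _ mx, triple_rho _ _ ny).
have in_gen z t : <<z @: setT>>%g = [set: Q] ->
    forall j, rho (t j) \in <<(rho \o z) @: setT>>%g.
  move=> z_gen j; pose P := [set q | rho q \in <<(rho \o z) @: setT>>%g].
  have P_group : group_set P.
    apply/group_setP; split=> [|a b]; first by rewrite inE (morph_one rhoM) group1.
    by rewrite !inE rhoM; apply: groupM.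
  have: <<z @: setT>>%g \subset P.
    rewrite (gen_subG _ (group P_group)); apply/subsetP=> _ /imsetP[i _ ->].
    by rewrite inE mem_gen // imset_f.
  by rewrite z_gen => /subsetP/(_ (t j)); rewrite !inE; apply.
have eq_boundary : boundary (rho \o x) @: families V = boundary (rho \o y) @: families V.
  apply/eqP; rewrite eqEsubset; apply/andP; split.
    by apply: boundary_image_sub => //; apply: in_gen.
  by apply: boundary_image_sub => //; apply: in_gen.
have := card_cocycles pM V_zmod V_shift (a := rho \o x) x_prod m_gt0 co_m xm.
rewrite (card_cocycles pM V_zmod V_shift (a := rho \o y) y_prod n_gt0 co_n yn).
rewrite eq_boundary.
have -> : #|cocycles V (rho \o y) n| = #|cocycles V (rho \o x) m|.
  by apply/eqP; rewrite eqn_leq !leq_card_cocycles.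
have b_gt0 : (0 < #|boundary (rho \o y) @: families V|)%N.
  apply/card_gt0P; exists (boundary (rho \o y) 0); apply: imset_f.
  by case: (families_zmod V_zmod).
have c_gt0 : (0 < #|cocycles V (rho \o x) m|)%N.
  apply/card_gt0P; exists 0.
  apply/(cocyclesP pM V_zmod V_shift (a := rho \o x) x_prod _ m_gt0 co_m xm).
  have [S0 _] := families_zmod V_zmod; exists 0; rewrite // /boundary /diff; split.
    by rewrite !ffunE !(raddf0, addr0).
  by apply/ffunP=> i; rewrite !ffunE !(raddf0, addr0).
by move/eqP; rewrite !eqn_pmul2l // => /eqP.
Qed.
End Comparison.

(** * Permutation modules of coset spaces *)

Section RightInvariant.
Variables (A : finZmodType) (G : finGroupType) (K : {group G}).

(** The functions on the coset space [G / K] with values in [A]. *)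
Definition right_invariant : {set {ffun G -> A}} :=
  [set u : {ffun G -> A} | [forall g, forall k in K, u (g * k)%g == u g]].

Lemma right_invariantP (u : {ffun G -> A}) :
  reflect (forall g k, k \in K -> u (g * k)%g = u g) (u \in right_invariant).
Proof.
rewrite inE; apply: (iffP forallP) => [uK g k Kk|uK g].
  by apply/eqP; have /forall_inP := uK g; apply.
by apply/forall_inP=> k Kk; rewrite uK.
Qed.

Lemma right_invariant_zmod : zmod_closed (mem right_invariant).
Proof.
split=> [|u v /right_invariantP uK /right_invariantP vK]; apply/right_invariantP=> g k Kk.
  by rewrite !ffunE.
by rewrite !ffunE uK ?vK.
Qed.

Lemma right_invariant_shift a u :
  u \in right_invariant -> shift a u \in right_invariant.
Proof.
by move=> /right_invariantP uK; apply/right_invariantP=> g k Kk; rewrite !ffunE mulgA uK.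
Qed.

(** Invariance under the shift by [a] as well makes these the functions constant on double
    cosets. *)
Lemma card_invariants a :
  #|invariants right_invariant a| = (#|A| ^ #|dcosets <[a]> K|)%N.
Proof.
rewrite -(card_act_invariant 0); apply: eq_card => u.
rewrite inE [RHS]inE; apply/andP/forallP => [[/right_invariantP uK /eqP ua] g|uCK].
  apply/forall_inP=> -[c k]; rewrite inE /= => /andP[/cycleP[j ->] Kk].
  rewrite /dcoset_act /= uK // {k Kk}; apply/eqP.
  elim: j => [|j IHj]; first by rewrite expg0 invg1 mul1g.
  by rewrite expgSr invMg -mulgA -IHj -[in RHS]ua ffunE.
have {}uCK g c k : c \in <[a]>%g -> k \in K -> u (c^-1 * g * k)%g = u g.
  move=> ac Kk; have /forall_inP/(_ (c, k)) := uCK g.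
  by rewrite inE /= ac Kk => /(_ isT)/eqP.
split; first by apply/right_invariantP=> g k /(uCK g 1%g k (group1 _)); rewrite invg1 mul1g.
by apply/eqP/ffunP=> g; rewrite ffunE -[in RHS](uCK g a 1%g) ?cycle_id ?group1 // mulg1.
Qed.
End RightInvariant.

Lemma perm_eq_image_orders (A : finZmodType) (p : nat) (Q G : finGroupType)
    (rho : Q -> G) (m n : 'I_3 -> nat) (x y : 'I_3 -> Q) :
    (1 < #|A|)%N -> (forall u : {ffun G -> A}, u *+ p = 0) ->
    {morph rho : a b / (a * b)%g} ->
    <<x @: setT>>%g = setT -> <<y @: setT>>%g = setT ->
    universal_for (wreath A G) m x -> universal_for (wreath A G) n y ->
    triangle_triple m x -> triangle_triple n y ->
    (forall i, (0 < m i)%N) -> (forall i, (0 < n i)%N) ->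
    (forall i, coprime (m i) p) -> (forall i, coprime (n i) p) ->
  perm_eq [seq #[rho (x i)] | i : 'I_3] [seq #[rho (y i)] | i : 'I_3].
Proof.
move=> A_gt1 pM rhoM x_gen y_gen x_fact y_fact mx ny m_gt0 n_gt0 co_m co_n.
apply: (perm_eq_orders (x := rho \o x) (y := rho \o y)) => K.
have := prod_card_invariants pM rhoM x_gen y_gen x_fact y_fact mx ny m_gt0 n_gt0
  co_m co_n (right_invariant_zmod A K) (@right_invariant_shift A G K).
rewrite !(eq_bigr _ (fun i _ => card_invariants _ _ _)) -!expn_sum.
by move/eqP; rewrite eqn_exp2l // => /eqP.
Qed.

(** * Realizing the periods in PGL_2 *)

(* l and k are the eigenvalues of a: a power of a is scalar when they agree on it. *)
Lemma quadratic_pow (F : comNzRingType) (R : algType F) (l k : F) (a : R) n :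
    l * k = 1 -> a * a = (l + k) *: a - 1 ->
  (l - k) *: a ^+ n.+1 = (l ^+ n.+1 - k ^+ n.+1) *: a - (l ^+ n - k ^+ n)%:A.
Proof.
move=> lk aa; elim: n => [|n IHn].
  by rewrite !expr1 !expr0 subrr scale0r subr0.
rewrite exprSr scalerAl IHn mulrBl -scalerAl aa mulr_algl scalerBr scalerA.
rewrite addrAC -scalerBl; congr (_ *: _ - _).
have lk' m : l * k * (l ^+ m - k ^+ m) = l ^+ m - k ^+ m by rewrite lk mul1r.
by rewrite -(lk' n) !exprS; ring.
Qed.

(** For a prime [p] above [N], Euler's theorem makes [N] divide [p ^ totient N - 1], the order of
    the cyclic multiplicative group of the field with [p ^ totient N] elements. *)
Lemma finField_prim_root (N : nat) : (0 < N)%N ->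
  exists (F : finFieldType) (z : F), N.-primitive_root z.
Proof.
move=> N_gt0; have [p Np p_pr] := prime_above N.
have co_pN : coprime p N.
  by rewrite prime_coprime //; apply/negP => /(dvdn_leq N_gt0); rewrite leqNgt Np.
have t_gt0 : (0 < totient N)%N by rewrite totient_gt0.
have [F _ cardF] := PrimePowerField p_pr t_gt0; exists F.
have N_dvd : (N %| #|F|.-1)%N.
  rewrite -subn1 -eqn_mod_dvd ?cardF; first exact/eqP/Euler_exp_totient.
  by rewrite expn_gt0 prime_gt0.
have F1_gt0 : (0 < #|F|.-1)%N by rewrite -subn1 subn_gt0 finNzRing_gt1.
pose rs := enum (predC1 (0 : F)).
have /hasP[z _ z_prim] : has #|F|.-1.-primitive_root rs.
  apply: has_prim_root => //.
  - apply/allP=> x; rewrite mem_enum inE => x0; apply/unity_rootP.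
    apply: (mulIf x0); rewrite mul1r -exprSr prednK ?expf_card //.
    by rewrite (leq_trans _ (finNzRing_gt1 F)).
  - exact: enum_uniq.
  - by rewrite -cardE cardC1.
by exists (z ^+ (#|F|.-1 %/ N)); apply: dvdn_prim_root.
Qed.

Section CentralQuotient.
Variables (F : finFieldType).
Local Notation U := {unit 'M[F]_2}.
Local Notation Z := 'Z([set: U])%G.

(** In [quadratic_pow] with [k = l^-1], a power of [a] is central exactly when the coefficient of
    [a] vanishes: otherwise [a] would commute with [b]. As [l] has order [2 * r], this happens
    exactly when [r] divides the exponent. *)
Lemma order_coset_quadratic (r : nat) (l : F) (a b : U) :
    (1 < r)%N -> (2 * r).-primitive_root l ->
    val a * val a = (l + l^-1) *: val a - 1 -> val a * val b != val b * val a ->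
  #[coset Z a] = r.
Proof.
move=> r_gt1 l_prim aa ab.
have l_neq0 : l != 0 by rewrite (prim_root_eq0 l_prim) muln_eq0 -lt0n ltnW.
have ll : l * l^-1 = 1 by rewrite mulfV.
have NZ (c : U) : c \in 'N(Z)%g.
  by have /andP[_ /subsetP] := center_normal [set: U]; apply; rewrite inE.
have ll_neq0 : l - l^-1 != 0.
  rewrite subr_eq0; apply: contraTneq r_gt1 => lV.
  have : l ^+ 2 == 1 by rewrite expr2 {2}lV ll.
  rewrite -(prim_order_dvd l_prim) => /(dvdn_leq (isT : 0 < 2)%N).
  by rewrite -[X in (_ <= X)%N]muln1 leq_pmul2l // -leqNgt.
have u_eq0 n : (l ^+ n - l^-1 ^+ n == 0) = (r %| n)%N.
  rewrite subr_eq0 exprVn -(inj_eq (mulIf (expf_neq0 n l_neq0))) mulVf ?expf_neq0 //.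
  by rewrite -exprD addnn -mul2n -(prim_order_dvd l_prim) dvdn_pmul2l.
have a_pow n : (coset Z a ^+ n == 1)%g = (r %| n)%N.
  rewrite -morphX ?NZ //=.
  have -> : (coset Z (a ^+ n) == 1)%g = (a ^+ n \in Z)%g.
    by apply/eqP/idP=> [/coset_idr->|/coset_id].
  case: n => [|n]; first by rewrite expg0 group1 dvdn0.
  have a_n := quadratic_pow n ll aa.
  rewrite -u_eq0; apply/idP/eqP => [/setIP[_ /centP/(_ b)]|u0].
    rewrite inE => /(_ isT)/(congr1 val); rewrite !FinRing.val_unitM !FinRing.val_unitX.
    move=> anb.
    apply/eqP; apply: contraNT ab => u0.
    apply/eqP/(scalerI u0)/(addIr (- ((l ^+ n - l^-1 ^+ n) *: val b))).
    have e1 := congr1 ( *%R^~ (val b)) a_n; have e2 := congr1 ( *%R (val b)) a_n.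
    rewrite /= -scalerAl mulrBl -scalerAl mulr_algl in e1.
    rewrite /= -scalerAr mulrBr -scalerAr mulr_algr in e2.
    by rewrite -e1 -e2 anb.
  apply/setIP; split; first by rewrite inE.
  apply/centP=> c _; apply: val_inj; rewrite !FinRing.val_unitM !FinRing.val_unitX.
  apply: (scalerI ll_neq0); rewrite scalerAl scalerAr a_n u0 scale0r sub0r.
  by rewrite mulNr mulrN mulr_algl mulr_algr.
apply/eqP; rewrite eqn_dvd order_dvdn a_pow dvdnn /= -a_pow.
by rewrite expg_order.
Qed.
End CentralQuotient.

Section Matrices2.
Variable F : fieldType.

Definition mx2 (a b c d : F) : 'M[F]_2 :=
  \matrix_(i, j) (if i == 0 then if j == 0 then a else b else if j == 0 then c else d).

Lemma mx2M a b c d a' b' c' d' :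
  mx2 a b c d * mx2 a' b' c' d' =
    mx2 (a * a' + b * c') (a * b' + b * d') (c * a' + d * c') (c * b' + d * d').
Proof.
apply/matrixP=> i j; rewrite !mxE !big_ord_recl big_ord0 !mxE /= addr0.
by case: ifP; case: ifP.
Qed.

Lemma mx2_quadratic a b c d t : a * d - b * c = 1 -> a + d = t ->
  mx2 a b c d * mx2 a b c d = t *: mx2 a b c d - 1.
Proof.
move=> det1 <-; rewrite mx2M; apply/matrixP=> i j; rewrite !mxE -det1.
case: i => [[|[|//]] lti]; case: j => [[|[|//]] ltj];
  by rewrite !(eqE, eqxx) /= ?mulr1n ?mulr0n ?subr0; ring.
Qed.

Lemma mx2_unit a b c d : a * d - b * c = 1 -> mx2 a b c d \is a GRing.unit.
Proof.
move=> det1; set A := mx2 _ _ _ _.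
have AA : A * A = (a + d) *: A - 1 by apply: mx2_quadratic.
apply/unitrP; exists ((a + d)%:A - A).
by rewrite mulrBl mulrBr mulr_algl mulr_algr AA !opprB addrC subrK.
Qed.
End Matrices2.

(** Two triangular matrices of determinant 1 carry the eigenvalues for [r] and [s]; one free entry
    adjusts the trace of their product to fit [t]. The orders are then read off modulo the
    center. *)
Lemma smooth_triple_gt1 (r s t : nat) : (1 < r)%N -> (1 < s)%N -> (1 < t)%N ->
  exists (H : finGroupType) (a b c : H),
    [/\ (a * b * c = 1)%g, #[a] = r, #[b] = s & #[c] = t].
Proof.
move=> r_gt1 s_gt1 t_gt1.
have N_gt0 : (0 < 2 * (r * s * t))%N 
  by rewrite !muln_gt0 /= !(ltnW r_gt1, ltnW s_gt1, ltnW t_gt1).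
have [F [z z_prim]] := finField_prim_root N_gt0.
have root_dvd d : (d %| r * s * t)%N -> exists l : F, (2 * d).-primitive_root l.
  move=> d_dvd; exists (z ^+ (2 * (r * s * t) %/ (2 * d))).
  by apply: (dvdn_prim_root z_prim); rewrite dvdn_pmul2l.
have [l l_prim] : exists l : F, (2 * r).-primitive_root l.
  by apply: root_dvd; rewrite -mulnA dvdn_mulr.
have [k k_prim] : exists k : F, (2 * s).-primitive_root k.
  by apply: root_dvd; rewrite mulnAC dvdn_mull.
have [h h_prim] : exists h : F, (2 * t).-primitive_root h.
  by apply: root_dvd; rewrite dvdn_mull.
have nz d (x : F) : (1 < d)%N -> (2 * d).-primitive_root x -> x != 0.
  by move=> d_gt1 x_prim; rewrite (prim_root_eq0 x_prim) muln_eq0 -lt0n ltnW.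
have [l0 k0] := (nz _ _ r_gt1 l_prim, nz _ _ s_gt1 k_prim).
(* e is chosen to give A * B the trace h + h^-1. *)
pose e := h + h^-1 - l * k - l^-1 * k^-1.
pose A := mx2 l 1 0 l^-1; pose B := mx2 k 0 e k^-1.
have AB : A * B = mx2 (l * k + e) k^-1 (l^-1 * e) (l^-1 * k^-1).
  by rewrite mx2M; congr mx2; ring.
have detA : l * l^-1 - 1 * 0 = 1 by rewrite mulr0 subr0 mulfV.
have detB : k * k^-1 - 0 * e = 1 by rewrite mul0r subr0 mulfV.
have detAB : (l * k + e) * (l^-1 * k^-1) - k^-1 * (l^-1 * e) = 1.
  by field; rewrite l0 k0.
pose a : {unit 'M[F]_2} := FinRing.Unit (mx2_unit detA).
pose b : {unit 'M[F]_2} := FinRing.Unit (mx2_unit detB).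
have aa : val a * val a = (l + l^-1) *: val a - 1 by apply: mx2_quadratic.
have bb : val b * val b = (k + k^-1) *: val b - 1 by apply: mx2_quadratic.
have cc : val (a * b)%g * val (a * b)%g = (h + h^-1) *: val (a * b)%g - 1.
  rewrite FinRing.val_unitM /= AB; apply: mx2_quadratic => //.
  by rewrite /e; ring.
have kV : k^-1 != k.
  apply: contraTneq s_gt1 => kV; have : k ^+ 2 == 1 by rewrite expr2 -{1}kV mulVf.
  rewrite -(prim_order_dvd k_prim) => /(dvdn_leq (isT : 0 < 2)%N).
  by rewrite -[X in (_ <= X)%N]muln1 leq_pmul2l // -leqNgt.
(* The upper right entries of the two products are [k^-1] and [k]. *)
have ab : val a * val b != val b * val a.
  apply: contraNneq kV => /=; rewrite AB mx2M => /matrixP/(_ 0 1).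
  by rewrite !mxE /= mulr1 mul0r addr0 => ->.
have abb : val (a * b)%g * val b != val b * val (a * b)%g.
  rewrite FinRing.val_unitM mulrA (inj_eq (mulIr _)) //.
  exact: (valP b).
pose Z := 'Z([set: {unit 'M[F]_2}])%G.
have NZ c : c \in 'N(Z)%g.
  by have /andP[_ /subsetP] := center_normal [set: {unit 'M[F]_2}]; apply; rewrite inE.
exists (coset_of Z), (coset Z a), (coset Z b), (coset Z (a * b)^-1); split.
- by rewrite -!morphM ?NZ // mulgV morph1.
- exact: (order_coset_quadratic r_gt1 l_prim aa ab).
- by apply: (order_coset_quadratic s_gt1 k_prim bb); rewrite eq_sym; exact: ab.
- rewrite morphV ?NZ // orderV; exact: (order_coset_quadratic t_gt1 h_prim cc abb).
Qed.

Local Close Scope ring_scope.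

(** * Finite quotients of a presented group *)

(** The universal property of the triangle group with periods [n], stated without words so that it
    carries over to other generators and to isomorphic groups. *)
Record presented (G : groupType) (n : 'I_3 -> nat) (x : 'I_3 -> G) : Prop := Presented {
  presented_triple : triangle_triple n x;
  presented_lift : forall (H : groupType) (w : 'I_3 -> H), triangle_triple n w ->
    exists2 f : G -> H, {morph f : a b / a * b} & f \o x =1 w;
  presented_uniq : forall (H : groupType) (f h : G -> H),
    {morph f : a b / a * b} -> {morph h : a b / a * b} ->
    f \o x =1 h \o x -> f =1 h }.

Lemma is_quotientP (G H : groupType) :
  is_quotient G H <->
  exists2 f : G -> H, {morph f : a b / a * b} & forall h, exists g, f g = h.
Proof.
split=> [[f f_surj]|[f fM f_surj]]; first by exists f => // a b; rewrite gmulfM.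
pose fm := isMultiplicative.Build G H f fM.
pose F : {multiplicative G -> H} := HB.pack f fm.
by exists F.
Qed.

(** Lift the images of the generators into the subgroup [S] they generate; followed by the inclusion
    this lift equals [f], by uniqueness, so the surjection [f] has its values in [S]. *)
Lemma gen_presented_image (G : groupType) n (x : 'I_3 -> G) (Q : finGroupType) (f : G -> Q) :
    presented n x -> {morph f : a b / a * b} -> (forall q, exists g, f g = q) ->
  <<(f \o x) @: setT>> = setT.
Proof.
move=> [nx lift uniq] fM f_surj; set S := <<_>>.
have fxS i : f (x i) \in S by rewrite mem_gen // (imset_f (f \o x)).
pose w i := subg S (f (x i)).
have wK i : sgval (w i) = f (x i) by rewrite subgK.
have nw : triangle_triple n w.
  have /andP[/eqP fx_prod /forallP fxn] := triangle_triple_morph fM nx.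
  apply/andP; split; first by apply/eqP/val_inj; rewrite /= !wK.
  apply/forallP=> i; apply/eqP/val_inj; rewrite /= -(eqP (fxn i)).
  by rewrite (morph_expg (f := @sgval _ _)) ?wK.
have [h hM hx] := lift _ w nw.
apply/setP=> q; rewrite !inE; have [g <-] := f_surj q.
rewrite -(uniq _ (sgval \o h) f) ?subgP //= => [a b|i]; first by rewrite /= hM.
by rewrite /= -wK -hx.
Qed.

(** All triangle triples in [W] are combined into one homomorphism to a power of [W]; [Q] is its
    image, and the coordinate projections recover the triples. *)
Lemma universal_quotient (G : groupType) n (x : 'I_3 -> G) (W : finGroupType) :
    presented n x ->
  exists (Q : finGroupType) (f : G -> Q),
    [/\ {morph f : a b / a * b}, forall q, exists g, f g = q & universal_for W n (f \o x)].
Proof.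
move=> [nx lift uniq].
pose P : finGroupType := {dffun forall w : {ffun 'I_3 -> W}, (fun=> W) w}.
(* Coordinates indexed by families that are not triangle triples are set to 1, so that [t] still
   satisfies the relations. *)
pose t i : P := [ffun w : {ffun 'I_3 -> W} => if triangle_triple n w then w i else 1].
have expgE (v : P) k (w : {ffun 'I_3 -> W}) : (v ^+ k) w = v w ^+ k.
  elim: k => [|k IHk]; first by rewrite !expg0 ffunE.
  by rewrite !expgS ffunE IHk.
have nt : triangle_triple n t.
  apply/andP; split.
    apply/eqP/ffunP=> w; rewrite !ffunE; case: ifP => [/andP[/eqP]//|_].
    by rewrite !mulg1.
  apply/forallP=> i; apply/eqP/ffunP=> w; rewrite expgE !ffunE.
  by case: ifP => [/andP[_ /forallP/(_ i)/eqP]|_]; rewrite ?expg1n.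
have [u uM ux] := lift P t nt.
pose I := [set p : P | `[< exists g, u g = p >]].
have I_group : group_set I.
  apply/group_setP; split=> [|_ _ /[!inE]/asboolP[a <-] /asboolP[b <-]].
    by rewrite inE; apply/asboolP; exists 1; rewrite morph_one.
  by apply/asboolP; exists (a * b); rewrite uM.
pose IG := Group I_group.
have uI g : u g \in IG by rewrite inE; apply/asboolP; exists g.
have fK g : sgval (subg IG (u g)) = u g by rewrite subgK.
exists (subg_of IG : finGroupType), (fun g => subg IG (u g)); split.
- by move=> a b; apply: val_inj; rewrite /= !fK uM.
- move=> q; have := subgP q; rewrite inE => /asboolP[g ug].
  by exists g; apply: val_inj; rewrite /= fK.
move=> w nw; pose w' := [ffun i => w i].
exists (fun q => (sgval q : P) w') => [a b|i]; first by rewrite /= ffunE.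
rewrite /= fK; have /= -> := ux i; rewrite !ffunE.
by rewrite (eq_triangle_triple n (h := w)) ?nw // => j; rewrite ffunE.
Qed.

Definition triples (W : finGroupType) n : {set {ffun 'I_3 -> W}} :=
  [set w : {ffun 'I_3 -> W} | triangle_triple n w].

Section Quotient.
Variables (S : groupType) (m n : 'I_3 -> nat) (y : 'I_3 -> S) (Q W : finGroupType).
Variables (x : 'I_3 -> Q) (f : S -> Q).
Hypotheses (yP : presented n y) (x_gen : <<x @: setT>> = setT).
Hypotheses (fM : {morph f : a b / a * b}) (f_surj : forall q, exists s, f s = q).
Hypothesis x_fact : universal_for W m x.

(** A triple for [m] extends along [x] to a homomorphism [h] on [Q], whose values at [f \o y] form a
    triple for [n]; these values determine [h], since [f] is onto and a homomorphism on [S] is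
    determined at [y]. *)
Let transport : exists2 F : {ffun 'I_3 -> W} -> {ffun 'I_3 -> W},
  {in triples W m &, injective F} &
  forall w, w \in triples W m -> F w \in triples W n /\
    exists2 h : Q -> W, {morph h : a b / a * b} & h \o (f \o y) =1 F w.
Proof.
have ex_v (w : {ffun 'I_3 -> W}) : exists v : {ffun 'I_3 -> W}, w \in triples W m ->
    v \in triples W n /\
    exists h : Q -> W, [/\ {morph h : a b / a * b}, h \o x =1 w & h \o (f \o y) =1 v].
  have [|_] := boolP (w \in _); last by exists 1.
  rewrite inE => /x_fact[h hM hx]; exists [ffun i => h (f (y i))] => _; split.
    rewrite inE (eq_triangle_triple n (h := h \o (f \o y))) => [|i]; last by rewrite ffunE.
    by apply: triangle_triple_morph => //; apply: triangle_triple_morph (presented_triple yP).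
  by exists h; split=> // i; rewrite ffunE.
have [F FP] := fin_all_exists ex_v.
exists F => [w w' /FP[_ [h [hM hx hy]]] /FP[_ [k [kM kx ky]]] Fww'|w /FP[Fw [h [hM _ hy]]]].
  have hk : h =1 k.
    move=> q; have [s <-] := f_surj q.
    apply: (presented_uniq yP (f := h \o f) (h := k \o f)) => [a b|a b|i].
    - by rewrite /= fM hM.
    - by rewrite /= fM kM.
    by have /= -> := hy i; rewrite Fww' -ky.
  by apply/ffunP=> i; rewrite -hx -kx /= hk.
by split=> //; exists h.
Qed.

Lemma leq_card_triples : (#|triples W m| <= #|triples W n|)%N.
Proof.
have [F F_inj FP] := transport; rewrite -(card_in_imset F_inj).
by apply/subset_leq_card/subsetP=> _ /imsetP[w /FP[Fw _] ->].
Qed.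

(** The reverse inequality of cardinals makes the injection [F] onto, so every triple for [n] comes
    from a homomorphism on [Q]. *)
Lemma universal_for_of_card : (#|triples W n| <= #|triples W m|)%N -> universal_for W n (f \o y).
Proof.
move=> le_nm; have [F F_inj FP] := transport => w nw.
pose w' := [ffun i => w i].
have w'_n : w' \in triples W n.
  by rewrite inE (eq_triangle_triple n (h := w)) // => i; rewrite ffunE.
have /setP/(_ w') : F @: triples W m = triples W n.
  apply/eqP; rewrite eqEcard (card_in_imset F_inj) le_nm andbT.
  by apply/subsetP=> _ /imsetP[v /FP[Fv _] ->].
rewrite w'_n => /imsetP[v /FP[_ [h hM hv]] wv].
by exists h => // i; rewrite hv -wv ffunE.
Qed.
End Quotient.

(** [Q] is built universal for [G] and is also a quotient of [S]. The quotient [Q'] universal for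
    [S] serves only to bound the number of triples for [n] by that for [m], which makes [Q]
    universal for [S] too. *)
Lemma common_quotient (G S : groupType) (m n : 'I_3 -> nat)
    (x : 'I_3 -> G) (y : 'I_3 -> S) (W : finGroupType) :
    presented m x -> presented n y ->
    (forall Q : finGroupType, is_quotient G Q <-> is_quotient S Q) ->
  exists (Q : finGroupType) (x' y' : 'I_3 -> Q),
    [/\ <<x' @: setT>> = setT, <<y' @: setT>> = setT, 
        triangle_triple m x', triangle_triple n y'
      & universal_for W m x' /\ universal_for W n y'].
Proof.
move=> xP yP GS.
have [Q [f [fM f_surj f_fact]]] := universal_quotient W xP.
have [Q' [f' [f'M f'_surj f'_fact]]] := universal_quotient W yP.
have /is_quotientP[h hM h_surj] : is_quotient S Q.
  by apply/GS/is_quotientP; exists f.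
have /is_quotientP[h' h'M h'_surj] : is_quotient G Q'.
  by apply/GS/is_quotientP; exists f'.
have le_nm := leq_card_triples xP h'M h'_surj f'_fact.
exists Q, (f \o x), (h \o y); split.
- exact: gen_presented_image xP fM f_surj.
- exact: gen_presented_image yP hM h_surj.
- exact: (triangle_triple_morph fM (presented_triple xP)).
- exact: (triangle_triple_morph hM (presented_triple yP)).
by split=> //; apply: (universal_for_of_card yP hM h_surj f_fact le_nm).
Qed.

(** * Presentations of triangle groups *)

Definition vec3 (T : Type) (a b c : T) : 'I_3 -> T := fun i => nth a [:: a; b; c] i.

Lemma vec3E (T : Type) (a b c : T) :
  (vec3 a b c i0 = a) * (vec3 a b c i1 = b) * (vec3 a b c i2 = c).
Proof. by rewrite /vec3 /= !inordK. Qed.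

Lemma triangle_tripleP (G : groupType) r s t (g : 'I_3 -> G) :
  reflect [/\ g i0 * g i1 * g i2 = 1, g i0 ^+ r = 1, g i1 ^+ s = 1 & g i2 ^+ t = 1]
    (triangle_triple (vec3 r s t) g).
Proof.
apply: (iffP andP) => [[/eqP g1 /forallP gn]|[g1 g0r g1s g2t]].
  by split=> //; [have := gn i0 | have := gn i1 | have := gn i2];
     rewrite !vec3E => /eqP.
by split; [apply/eqP | apply/forallP; apply: ord3P; rewrite !vec3E; apply/eqP].
Qed.

Definition triangle_type r s t (G : groupType) :=
  exists x : 'I_3 -> G, presented (vec3 r s t) x.

Lemma presented_triangle_group r s t : triangle_type r s t (triangle_group r s t).
Proof.
pose R := triangle_relators r s t.
have evalP (G : groupType) (g : 'I_3 -> G) :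
    triangle_triple (vec3 r s t) g <-> (forall w, w \in R -> word_eval g w = 1).
  have eval_nseq n i : word_eval g (nseq n (i, false)) = g i ^+ n.
    elim: n => [|n IHn]; first by rewrite /word_eval big_nil expg0.
    by rewrite /word_eval big_cons -/(word_eval g _) IHn expgS.
  have eval3 : word_eval g [:: (i0, false); (i1, false); (i2, false)] = g i0 * g i1 * g i2.
    by rewrite /word_eval !big_cons big_nil /= mulg1 mulgA.
  split=> [/triangle_tripleP[g1 g0r g1s g2t] w|Rg].
    by rewrite !inE => /or4P[] /eqP->; rewrite ?eval_nseq ?eval3.
  apply/triangle_tripleP; rewrite -eval3 -!eval_nseq.
  by split; apply: Rg; rewrite !inE eqxx ?orbT.
exists (@pres_gen _ R); split.
- by apply/evalP => w; apply: pres_relator_eq1.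
- move=> H w /evalP/pres_lift[f [[fM fw] _]]; by exists f.
move=> H f h fM hM fh.
have Rf : forall w, w \in R -> word_eval (fun i => f (pres_gen R i)) w = 1.
  by apply/evalP/(triangle_triple_morph fM)/evalP => w; apply: pres_relator_eq1.
have [k [_ k_uniq]] := pres_lift Rf.
by move=> a; rewrite -(k_uniq f (conj fM (fun=> erefl))) -(k_uniq h (conj hM (fsym fh))).
Qed.

Lemma isomorphic_triangle_type r s t (G H : groupType) :
  isomorphic G H -> triangle_type r s t H -> triangle_type r s t G.
Proof.
move=> [f [g gf fg]] [y [ny lift uniq]].
have fM : {morph f : a b / a * b} by move=> a b; rewrite gmulfM.
have gM : {morph g : a b / a * b} by move=> a b; apply: (can_inj gf); rewrite fM !fg.
exists (g \o y); split; first exact: triangle_triple_morph.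
  move=> K w /lift[k kM kw]; exists (k \o f) => [a b|i]; first by rewrite /= fM kM.
  by rewrite /= fg -kw.
move=> K h k hM kM hk a; rewrite -(gf a).
by apply: (uniq _ (h \o g) (k \o g)) => [b c|b c|i]; rewrite /= ?gM ?hM ?kM //; apply: hk.
Qed.

Lemma triangle_type_isomorphic r s t (G H : groupType) :
  triangle_type r s t G -> triangle_type r s t H -> isomorphic G H.
Proof.
move=> [x [nx x_lift x_uniq]] [y [ny y_lift y_uniq]].
have [f fM fx] := x_lift _ _ ny; have [g gM gy] := y_lift _ _ nx.
pose fm := isMultiplicative.Build G H f fM.
pose F : {multiplicative G -> H} := HB.pack f fm.
exists F; exists g => a.
  apply: (x_uniq _ (g \o f) id) => [b c|//|i]; first by rewrite /= fM gM.
  by rewrite /= -[RHS]gy /= -fx.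
apply: (y_uniq _ (f \o g) id) => [b c|//|i]; first by rewrite /= gM fM.
by rewrite /= -[RHS]fx /= -gy.
Qed.

(** A change of generators: each triple [w] for [y] is matched by a triple [v] for [x], and
    morphisms agreeing on [y] agree on [x]. *)
Lemma presented_change (G : groupType) m n (x y : 'I_3 -> G) :
    presented m x -> triangle_triple n y ->
    (forall (H : groupType) (w : 'I_3 -> H), triangle_triple n w ->
      exists2 v, triangle_triple m v & forall f : G -> H,
        {morph f : a b / a * b} -> f \o x =1 v -> f \o y =1 w) ->
    (forall (H : groupType) (f h : G -> H),
      {morph f : a b / a * b} -> {morph h : a b / a * b} ->
      f \o y =1 h \o y -> f \o x =1 h \o x) ->
  presented n y.
Proof.
move=> [_ lift uniq] ny vw yx; split=> // [H w /vw[v /lift[f fM fv] fvw]|H f h fM hM fh].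
  by exists f => //; apply: fvw.
by apply: uniq => //; apply: yx.
Qed.

Lemma morph_inv (G H : groupType) (f : G -> H) :
  {morph f : a b / a * b} -> {morph f : a / a^-1}.
Proof.
by move=> fM a; apply: (mulgI (f a)); rewrite -fM !mulgV morph_one.
Qed.

Lemma triangle_type_rot r s t (G : groupType) :
  triangle_type r s t G -> triangle_type s t r G.
Proof.
move=> [x xP]; exists (vec3 (x i1) (x i2) (x i0)).
have rot_triple (H : groupType) (a b c : H) : a * b * c = 1 -> b * c * a = 1.
  by move=> abc; apply: (mulgI a); rewrite !mulgA abc mul1g mulg1.
apply: (presented_change xP).
- have /triangle_tripleP[] := presented_triple xP.
  by move=> *; apply/triangle_tripleP; rewrite !vec3E; split=> //; apply: (rot_triple).
- move=> H w /triangle_tripleP[w1 *]; exists (vec3 (w i2) (w i0) (w i1)).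
    by apply/triangle_tripleP; rewrite !vec3E; split=> //; do 2!apply: (rot_triple).
  move=> f fM fx; apply: ord3P; rewrite /= !vec3E.
  + by have /= -> := fx i1; rewrite vec3E.
  + by have /= -> := fx i2; rewrite vec3E.
  by have /= -> := fx i0; rewrite vec3E.
move=> H f h fM hM fh; apply: ord3P.
- by have := fh i2; rewrite /= !vec3E.
- by have := fh i0; rewrite /= !vec3E.
by have := fh i1; rewrite /= !vec3E.
Qed.

(** Inversion reverses products: since [c] is the inverse of [a * b], also
    [b^-1 * a^-1 * c^-1 = 1]. *)
Lemma triangle_type_swap r s t (G : groupType) :
  triangle_type r s t G -> triangle_type s r t G.
Proof.
move=> [x xP]; exists (vec3 (x i1)^-1 (x i0)^-1 (x i2)^-1).
have swap_triple (H : groupType) (a b c : H) : a * b * c = 1 -> b^-1 * a^-1 * c^-1 = 1.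
  move=> abc; have -> : c = (a * b)^-1 by apply: (mulgI (a * b)); rewrite abc mulgV.
  by rewrite invgK mulgA mulgKV mulVg.
apply: (presented_change xP).
- have /triangle_tripleP[] := presented_triple xP.
  move=> ? xr xs xt; apply/triangle_tripleP; rewrite !vec3E !expVgn xr xs xt !invg1.
  by split=> //; apply: (swap_triple).
- move=> H w /triangle_tripleP[w1 wr ws wt]; exists (vec3 (w i1)^-1 (w i0)^-1 (w i2)^-1).
    apply/triangle_tripleP; rewrite !vec3E !expVgn wr ws wt !invg1.
    by split=> //; apply: (swap_triple).
  move=> f fM fx; apply: ord3P; rewrite /= !vec3E (morph_inv fM).
  + by have /= -> := fx i1; rewrite vec3E invgK.
  + by have /= -> := fx i0; rewrite vec3E invgK.
  by have /= -> := fx i2; rewrite vec3E invgK.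
move=> H f h fM hM fh; apply: ord3P; apply: invg_inj.
  all: rewrite /= -(morph_inv fM) -(morph_inv hM).
- by have := fh i1; rewrite /= !vec3E.
- by have := fh i0; rewrite /= !vec3E.
by have := fh i2; rewrite /= !vec3E.
Qed.

(** The first generator is trivial, so the other two are inverse to each other and both exponents
    kill both of them. *)
Lemma triangle_type_gcd s t (G : groupType) : (0 < s)%N ->
  triangle_type 1 s t G -> triangle_type 1 (gcdn s t) (gcdn s t) G.
Proof.
move=> s_gt0 [x xP]; exists x.
have pow_gcd (H : groupType) (a b c : H) : a * b * c = 1 -> a ^+ 1 = 1 ->
    b ^+ s = 1 -> c ^+ t = 1 -> b ^+ gcdn s t = 1 /\ c ^+ gcdn s t = 1.
  rewrite expg1 => abc a1 bs ct; rewrite a1 mul1g in abc.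
  have cb : c = b^-1 by apply: (mulgI b); rewrite abc mulgV.
  suff bg : b ^+ gcdn s t = 1 by rewrite cb expVgn bg invg1.
  have bt : b ^+ t = 1 by apply: invg_inj; rewrite -expVgn -cb ct invg1.
  have [k l kl _] := egcdnP t s_gt0.
  have : b ^+ (k * s) = 1 by rewrite mulnC expgM bs expg1n.
  by rewrite kl expgD mulnC expgM bt expg1n mul1g.
have pow_dvd (H : groupType) (a : H) d e : (d %| e)%N -> a ^+ d = 1 -> a ^+ e = 1.
  by move=> /dvdnP[k ->] ad; rewrite mulnC expgM ad expg1n.
apply: (presented_change xP).
- have /triangle_tripleP[x1 xr xs xt] := presented_triple xP.
  by apply/triangle_tripleP; have [] := pow_gcd _ _ _ _ x1 xr xs xt.
- move=> H w /triangle_tripleP[w1 wr ws wt]; exists w => //.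
  apply/triangle_tripleP; split=> //.
    exact: pow_dvd (dvdn_gcdl s t) ws.
  exact: pow_dvd (dvdn_gcdr s t) wt.
by [].
Qed.

(** The rotation and the transposition generate all permutations of the three periods. *)
Lemma triangle_type_perm (G : groupType) r s t r' s' t' :
    perm_eq [:: r; s; t] [:: r'; s'; t'] ->
  triangle_type r s t G -> triangle_type r' s' t' G.
Proof.
have perm2 (a b a' b' : nat) : perm_eq [:: a; b] [:: a'; b'] ->
    (a = a' /\ b = b') \/ (a = b' /\ b = a').
  move=> ab; have : a \in [:: a'; b'] by rewrite -(perm_mem ab) mem_head.
  rewrite !inE => /orP[] /eqP a_eq; move: ab; rewrite a_eq.
    by rewrite perm_cons => /(@perm_small_eq _ [:: _] [:: _] isT)[->]; left.
  by rewrite (permPr (permEl (perm_catC [:: a'] [:: b']))) perm_cons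
    => /(@perm_small_eq _ [:: _] [:: _] isT)[->]; right.
move=> p; have : r \in [:: r'; s'; t'] by rewrite -(perm_mem p) mem_head.
rewrite !inE => /or3P[] /eqP r_eq; move: p; rewrite r_eq.
- rewrite perm_cons => /perm2[] [-> ->] //.
  by move/triangle_type_rot/triangle_type_swap/triangle_type_rot/triangle_type_rot.
- rewrite (permPr (permEl (perm_catCA [:: r'] [:: s'] [:: t']))) perm_cons.
  move=> /perm2[] [-> ->]; first exact: triangle_type_swap.
  by move/triangle_type_rot/triangle_type_rot.
rewrite (permPr (permEl (perm_catC [:: r'; s'] [:: t']))) perm_cons.
move=> /perm2[] [-> ->]; first exact: triangle_type_rot.
by move/triangle_type_rot/triangle_type_swap.
Qed.

(** * Periods as exact orders, and their recovery from the finite quotients *)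

Definition realizes_orders (n : 'I_3 -> nat) :=
  exists (H : finGroupType) (w : 'I_3 -> H),
    w i0 * w i1 * w i2 = 1 /\ forall i, #[w i] = n i.

(** Periods all above 1 are realized by [smooth_triple_gt1]. A period 1 is rotated to the front and
    the other two are replaced by their gcd, without changing the group. *)
Lemma triangle_group_realized (G : groupType) : is_triangle_group G ->
  exists r s t, [/\ (0 < r)%N, (0 < s)%N, (0 < t)%N, triangle_type r s t G
    & realizes_orders (vec3 r s t)].
Proof.
case=> r [s [t [r_gt0 s_gt0 t_gt0 G_rst]]].
have {}G_rst := isomorphic_triangle_type G_rst (presented_triangle_group r s t).
have deg s' t' : (0 < s')%N -> triangle_type 1 s' t' G ->
    exists r s t, [/\ (0 < r)%N, (0 < s)%N, (0 < t)%N, triangle_type r s t G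
      & realizes_orders (vec3 r s t)].
  move=> s'_gt0 /(triangle_type_gcd s'_gt0).
  have: (0 < gcdn s' t')%N by rewrite gcdn_gt0 s'_gt0.
  case: (gcdn s' t') => // g _ G_g; exists 1%N, g.+1, g.+1; split=> //.
  (* The gcd is [g.+1]; the additive group of integers modulo it supplies a generator and its
     inverse. *)
  exists 'I_g.+1, (vec3 1 (Zp1 : 'I_g.+1) Zp1^-1); rewrite !vec3E mul1g mulgV; split=> //.
  by apply: ord3P; rewrite !vec3E ?orderV ?order_Zp1 ?order1.
have [r_gt1|] := ltnP 1 r; last first.
  case: r r_gt0 G_rst => [|[|//]] // _ G_rst _; exact: deg G_rst.
have [s_gt1|] := ltnP 1 s; last first.
  case: s s_gt0 G_rst => [|[|//]] // _ /triangle_type_rot G_rst _; exact: deg G_rst.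
have [t_gt1|] := ltnP 1 t; last first.
  case: t t_gt0 G_rst => [|[|//]] // _ /triangle_type_rot/triangle_type_rot G_rst _.
  exact: deg G_rst.
exists r, s, t; split=> //.
have [H [a [b [c [abc ar bs ct]]]]] := smooth_triple_gt1 r_gt1 s_gt1 t_gt1.
by exists H, (vec3 a b c); rewrite !vec3E; split=> //; apply: ord3P; rewrite !vec3E.
Qed.

(** Equality of the sets of classes gives a quotient of [S] only up to isomorphism with [Q];
    composing with the isomorphism reaches [Q] itself. *)
Lemma finite_quotients_sub (G S : groupType) (Q : finGroupType) :
  finite_quotients G = finite_quotients S -> is_quotient G Q -> is_quotient S Q.
Proof.
move=> GS GQ; have : finite_quotients S (iso_class Q) by rewrite -GS; exists Q.
case=> H /is_quotientP[f fM f_surj] QH.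
have : iso_class Q H by rewrite QH; exists idfun; exists idfun.
case=> g [k gk kg]; have gM : {morph g : a b / a * b} by move=> a b; rewrite gmulfM.
have kM : {morph k : a b / a * b} by move=> a b; apply: (can_inj gk); rewrite gM !kg.
apply/is_quotientP; exists (k \o f) => [a b|q]; first by rewrite /= fM kM.
by have [s fs] := f_surj (g q); exists s; rewrite /= fs gk.
Qed.

Lemma perm_eq_of_quotients (G S : groupType) (m n : 'I_3 -> nat)
    (x : 'I_3 -> G) (y : 'I_3 -> S) :
    presented m x -> presented n y ->
    (forall i, 0 < m i)%N -> (forall i, 0 < n i)%N ->
    realizes_orders m -> realizes_orders n ->
    (forall Q : finGroupType, is_quotient G Q <-> is_quotient S Q) ->
  perm_eq [seq m i | i : 'I_3] [seq n i | i : 'I_3].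
Proof.
move=> xP yP m_gt0 n_gt0 [G1 [a [a1 am]]] [G2 [b [b1 bn]]] GS.
have [p p_gt p_pr] := prime_above (\max_i m i + \max_i n i)%N.
have co_p k : (0 < k)%N -> (k < p)%N -> coprime k p.
  move=> k_gt0 kp; rewrite coprime_sym prime_coprime //.
  by apply/negP => /(dvdn_leq k_gt0); rewrite leqNgt kp.
have co_m i : coprime (m i) p.
  apply: co_p => //; apply: leq_ltn_trans p_gt.
  by rewrite (leq_trans (leq_bigmax i)) ?leq_addr.
have co_n i : coprime (n i) p.
  apply: co_p => //; apply: leq_ltn_trans p_gt.
  by rewrite (leq_trans (leq_bigmax i)) ?leq_addl.
(* The product lets one group receive the realizations of both systems of periods. *)
pose G12 : finGroupType := (G1 * G2)%type.
pose W := wreath 'F_p G12.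
have [Q [x' [y' [x_gen y_gen mx ny [x_fact y_fact]]]]] := common_quotient W xP yP GS.
have triple_order (H : finGroupType) k (w : 'I_3 -> H) :
    w i0 * w i1 * w i2 = 1 -> (forall i, #[w i] = k i) -> triangle_triple k w.
  move=> w1 wk; apply/andP; split; first exact/eqP.
  by apply/forallP=> i; rewrite -wk expg_order.
have [h1 h1M h1x] : exists2 h : Q -> W, {morph h : u v / u * v} &
    forall i, h (x' i) = (0%R, (a i, 1)).
  apply: x_fact; apply: (triangle_triple_morph (f := fun g => (0%R, (g, 1)) : W)).
    move=> u v; rewrite /= -[RHS]/(wreath_mul _ _) /wreath_mul /= raddf0 addr0.
    by rewrite -[RHS]/(_, (_, 1 * 1)) mulg1.
  exact: triple_order.
have [h2 h2M h2y] : exists2 h : Q -> W, {morph h : u v / u * v} &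
    forall i, h (y' i) = (0%R, (1, b i)).
  apply: y_fact; apply: (triangle_triple_morph (f := fun g => (0%R, (1, g)) : W)).
    move=> u v; rewrite /= -[RHS]/(wreath_mul _ _) /wreath_mul /= raddf0 addr0.
    by rewrite -[RHS]/(_, (1 * 1, _)) mulg1.
  exact: triple_order.
(* The first coordinate comes from [h1], giving the [x' i] their exact orders; the second comes from
   [h2] and does the same for the [y' i]. *)
pose rho q : G12 := ((h1 q).2.1, (h2 q).2.2).
have rhoM : {morph rho : u v / u * v} by move=> u v; rewrite /rho h1M h2M.
(* The relations make the order of [rho (w i)] divide [k i]; its image under a projection has order
   exactly [k i], which gives the converse divisibility. *)
have rho_order (H : finGroupType) (f : G12 -> H) k (w : 'I_3 -> Q) :
    {morph f : u v / u * v} -> triangle_triple k w ->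
    (forall i, #[f (rho (w i))] = k i) -> forall i, #[rho (w i)] = k i.
  move=> fM /andP[_ /forallP wk] fk i; apply/eqP; rewrite eqn_dvd order_dvdn.
  rewrite -(morph_expg _ _ rhoM) (eqP (wk i)) (morph_one rhoM) eqxx -fk.
  by rewrite order_dvdn -(morph_expg _ _ fM) expg_order (morph_one fM) eqxx.
have x_order : forall i, #[rho (x' i)] = m i.
  by apply: (rho_order _ fst) => // i; rewrite /rho h1x am.
have y_order : forall i, #[rho (y' i)] = n i.
  by apply: (rho_order _ snd) => // i; rewrite /rho h2y bn.
rewrite -(eq_image (frefl _) x_order) -(eq_image (frefl _) y_order).
apply: (perm_eq_image_orders (A := 'F_p) (p := p) _ _ rhoM
  x_gen y_gen x_fact y_fact mx ny) => //.
  by rewrite card_Fp // prime_gt1.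
by move=> u; apply/ffunP=> g; rewrite !ffunE ffunMnE GRing.mulrn_pchar ?pchar_Fp.
Qed.

Theorem theorem8p1 (Gamma Sigma : groupType)
    (hGamma : is_triangle_group Gamma) (hSigma : is_triangle_group Sigma)
    (hC : finite_quotients Gamma = finite_quotients Sigma) :
  isomorphic Gamma Sigma.
Proof.
have [r [s [t [r0 s0 t0 G_rst Grst]]]] := triangle_group_realized hGamma.
have [r' [s' [t' [r'0 s'0 t'0 S_rst Srst]]]] := triangle_group_realized hSigma.
have [[x xP] [y yP]] := (G_rst, S_rst).
have vec3_gt0 a b c : (0 < a)%N -> (0 < b)%N -> (0 < c)%N ->
    forall i, (0 < vec3 a b c i)%N.
  by move=> a0 b0 c0; apply: ord3P; rewrite vec3E.
have vec3_codom a b c : [seq vec3 a b c i | i : 'I_3] = [:: a; b; c].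
  by rewrite /image_mem !enum_ordSl (eqP (_ : enum 'I_0 == [::])) // -size_eq0 size_enum_ord.
have := perm_eq_of_quotients xP yP
  (vec3_gt0 _ _ _ r0 s0 t0) (vec3_gt0 _ _ _ r'0 s'0 t'0) Grst Srst.
rewrite !vec3_codom => rst; apply: (triangle_type_isomorphic _ S_rst).
apply: triangle_type_perm G_rst; apply: rst => Q.
by split; apply: finite_quotients_sub.
Qed.
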